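(* Let $\mathrm Q=(\alpha_p)_{p\ge1}\subset\mathrm T^*$ be a simple path of weights with initialization $n_0$, let $n\ge n_0$, let $\varphi_0\in\mathfrak L_n^{\mathrm T}(\mathbb K)$ and let $\mathcal A\subset\mathcal J$ be an admissible set at $\varphi_0$. Then each law $\varphi\in\mathfrak L^{\mathrm T,\mathcal A}_{n,\varphi_0}(\mathbb K)$ admits an admissible set which contains $\mathcal A$. If moreover the cardinality of $\mathcal A$ is maximal, i.e. $|\mathcal A|=n-\dim_{\mathbb K}\mathrm T$, then: 1. a law $\varphi\in\mathfrak L_n^{\mathrm T}(\mathbb K)$ admits $\mathcal A$ as admissible set if and only if $\varphi_{ij}^k\ne0$ for all $\binom{k}{ij}\in\mathcal A$, $i<j$; 2. all laws of $\mathfrak L^{\mathrm T,\mathcal A}_{n,\varphi_0}(\mathbb K)$ admit $\mathcal A$ as admissible set; 3. $\mathfrak L^{\mathrm T,\mathcal A}_{n,\varphi_0}(\mathbb K)$ is contained in $\Sigma_n(\mathrm T)$, and its isomorphism classes are the traces of the $\Gamma$-orbits; 4. a law $\varphi\in\mathfrak L_n^{\mathrm T}(\mathbb K)$ admits $\mathcal A$ as admissible set if and only if there is an element $s\in\mathrm G_n$ such that $s*\varphi\in\mathfrak L^{\mathrm T,\mathcal A}_{n,\varphi_0}(\mathbb K)$.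
   Context: $\mathbb K$ is an algebraically closed field of characteristic $0$. $\mathrm T$ is a finite-dimensional $\mathbb K$-vector space (torus) and $(\alpha_p)_{p\ge1}$ a sequence in $\mathrm T^*$; for each $n$, $\mathrm T$ acts on $\mathbb K^n$ diagonally by $t\cdot e_i=\alpha_i(t)e_i$, and is identified with its image when the $\alpha_i$, $i\le n$, span $\mathrm T^*$. $\mathrm P_n=\{\alpha_1,\dots,\alpha_n\}$. $\mathfrak L_n^{\mathrm T}$ is the scheme of Lie algebra laws $\varphi$ on $\mathbb K^n$ admitting the elements of $\mathrm T$ as derivations, i.e. with structure constants $\varphi^k_{ij}=0$ unless $\alpha_i+\alpha_j=\alpha_k$. $\Sigma_n(\mathrm T)$ is the set of $\varphi\in\mathfrak L_n^{\mathrm T}(\mathbb K)$ such that $\mathrm T$ is a maximal torus of derivations of $\varphi$. Path of weights with initialization $n_0$: (1) $\alpha_1,\dots,\alpha_{n_0}$ span $\mathrm T^*$ and are strictly positive, i.e. there is $t\in\mathrm T$ with $\alpha_i(t)\in\mathbb Q_{>0}$ for $i\le n_0$; (2) $\Sigma_n(\mathrm T)\neq\emptyset$ for all $n\ge n_0$; (3) $\alpha_{n+1}\notin\mathrm P_n-\mathrm P_n$ for all $n\ge n_0$. It is simple if all weights are distinct. $\mathcal J$ is the set of multi-indices $\binom{k}{ij}$, $i<j\le n$, $k\le n$, with $\alpha_i+\alpha_j=\alpha_k$ (for a simple path $k$ is determined by $(i,j)$); it indexes the basis of $\mathrm C^2(\mathbb K^n,\mathbb K^n)^{\mathrm T}$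 formed by the elementary cochains. $\mathrm G_n=\mathrm{Gl}_n(\mathbb K)^{\mathrm T}_0$ is the identity component of the centralizer of $\mathrm T$ in $\mathrm{Gl}_n(\mathbb K)$; in the simple case it is the diagonal group $(\mathbb K^* )^n$, acting by $(s*\varphi)^k_{ij}=\frac{s_k}{s_is_j}\varphi^k_{ij}$. A subset $\mathcal A\subset\mathcal J$ is admissible at $\varphi$ if it is minimal such that the linear forms $L\mapsto(d_\varphi L)^\alpha$, $\alpha\in\mathcal A$, on $\mathrm C^1(\mathbb K^n,\mathbb K^n)^{\mathrm T}$ have maximal rank, equal to $\dim\mathrm B^2(\varphi,\varphi)^{\mathrm T}$, the dimension of the $\mathrm G_n$-orbit of $\varphi$ ($d_\varphi$ is the Chevalley–Eilenberg differential with adjoint coefficients). One says ''$\varphi$ admits $\mathcal A$ as admissible set''. $\mathfrak L^{\mathrm T,\mathcal A}_{n,\varphi_0}$ is the closed subscheme of $\mathfrak L_n^{\mathrm T}$ given by $\varphi^\alpha=(\varphi_0)^\alpha$, $\alpha\in\mathcal A$. $\Gamma=\mathrm H/\mathrm H_0$ is the finite group of components of the normalizer $\mathrm H$ of $\mathrm T$ in $\mathrm{Gl}_n(\mathbb K)$; here $\mathrm H_0=\mathrm G_n$, and $\Gamma$ acts on the set $\Sigma_n(\mathrm T)/\mathrm G_n$ of $\mathrm G_n$-orbits. The trace of a $\Gamma$-orbit on the slice is the set of laws of the slice whose $\mathrm G_n$-orbit belongs to this $\Gamma$-orbit. *)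

(* Defs.v *)
From HB Require Import structures.
From mathcomp Require Import all_boot all_order all_algebra.
From mathcomp Require Import all_classical.
From mathcomp Require Import mpoly.
Set Implicit Arguments.
Unset Strict Implicit.
Unset Printing Implicit Defensive.
Import GRing.Theory.
Local Open Scope ring_scope.
Local Open Scope classical_set_scope.

(* A bilinear map on K^n is stored by its structure constants: the
   multi-index (i, j, k) stands for the coefficient phi^k_ij of e_k in
   phi(e_i, e_j).  Indices start at 0 throughout. *)
Notation midx n := ('I_n * 'I_n * 'I_n)%type.
Notation bilin K n := {ffun midx n -> K^o}.

Section Bilinear.
Variables (K : closedFieldType) (n : nat).
Implicit Types (phi psi : bilin K n) (L D g : 'M[K]_n) (x y : 'cV[K]_n).

Definition bracket phi x y : 'cV[K]_n :=
  \col_k \sum_i \sum_j x i 0 * y j 0 * phi (i, j, k).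

Definition sconst (f : 'cV[K]_n -> 'cV[K]_n -> 'cV[K]_n) : bilin K n :=
  [ffun a => f (delta_mx a.1.1 0) (delta_mx a.1.2 0) a.2 0].

Definition lie_law phi :=
  (forall x, bracket phi x x = 0) /\
  (forall x y z, bracket phi x (bracket phi y z) +
                 bracket phi y (bracket phi z x) +
                 bracket phi z (bracket phi x y) = 0).

Definition derivation phi D := forall x y,
  D *m bracket phi x y = bracket phi (D *m x) y + bracket phi x (D *m y).

Definition torus_of_derivations phi (U : {vspace 'M[K]_n}) :=
  [/\ forall D, D \in U -> derivation phi D,
      forall D, D \in U -> diagonalizable D
    & forall D E, D \in U -> E \in U -> D *m E = E *m D].

Definition maximal_torus phi (U : {vspace 'M[K]_n}) :=
  torus_of_derivations phi U /\
  forall V, torus_of_derivations phi V -> (U <= V)%VS -> V = U.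

(* Chevalley-Eilenberg differential C^1 -> C^2, adjoint coefficients *)
Definition coboundary phi L : bilin K n :=
  sconst (fun x y => bracket phi x (L *m y) + bracket phi (L *m x) y
                     - L *m bracket phi x y).

(* action of gl_n on bilinear maps and on endomorphisms *)
Definition gl_act2 D (f : bilin K n) : bilin K n :=
  sconst (fun x y => D *m bracket f x y - bracket f (D *m x) y
                     - bracket f x (D *m y)).
Definition gl_act1 D L := D *m L - L *m D.

(* (g * phi)(x, y) = g (phi (g^-1 x, g^-1 y)) *)
Definition gact g phi : bilin K n :=
  sconst (fun x y => g *m bracket phi (invmx g *m x) (invmx g *m y)).

Definition isomorphic phi psi := exists2 g, g \in unitmx & psi = gact g phi.

Definition restr (A : {set midx n}) (f : bilin K n) : bilin K n :=
  [ffun a => if a \in A then f a else 0].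

Fact bracket_is_linear x y : linear (fun f => bracket f x y).
Proof.
move=> c f h; apply/matrixP=> k l; rewrite !mxE.
rewrite mulr_sumr -big_split; apply: eq_bigr => i _ /=.
rewrite mulr_sumr -big_split; apply: eq_bigr => j _ /=.
by rewrite !ffunE mulrDr mulrCA.
Qed.

Fact bracket_linearl f y : linear (fun x => bracket f x y).
Proof.
move=> c x x'; apply/matrixP=> k l; rewrite !mxE.
rewrite mulr_sumr -big_split; apply: eq_bigr => i _ /=.
rewrite mulr_sumr -big_split; apply: eq_bigr => j _ /=.
by rewrite !mxE !mulrDl !mulrA.
Qed.

Fact bracket_linearr f x : linear (bracket f x).
Proof.
move=> c y y'; apply/matrixP=> k l; rewrite !mxE.
rewrite mulr_sumr -big_split; apply: eq_bigr => i _ /=.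
rewrite mulr_sumr -big_split; apply: eq_bigr => j _ /=.
by rewrite !mxE mulrDr mulrDl mulrCA !mulrA.
Qed.

Fact coboundary_is_linear phi : linear (coboundary phi).
Proof.
move=> c L M; apply/ffunP=> -[[i j] k]; rewrite !ffunE /=.
rewrite !mulmxDl -!scalemxAl bracket_linearl bracket_linearr.
rewrite -[_ *: (_ : K^o)]/(_ * _) !mxE /=.
by rewrite !mulrDr !mulrN !opprD [LHS](AC (2*2*2) ((1*3*5)*(2*4*6))).
Qed.

Fact gl_act2_is_linear D : linear (gl_act2 D).
Proof.
move=> c f h; apply/ffunP=> -[[i j] k]; rewrite !ffunE /=.
rewrite !bracket_is_linear mulmxDr -scalemxAr.
rewrite -[_ *: (_ : K^o)]/(_ * _) !mxE /=.
by rewrite !mulrDr !mulrN !opprD [LHS](AC (2*2*2) ((1*3*5)*(2*4*6))).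
Qed.

Fact gl_act1_is_linear D : linear (gl_act1 D).
Proof.
move=> c L M; rewrite /gl_act1 mulmxDr mulmxDl -scalemxAr -scalemxAl.
by rewrite scalerBr opprD addrACA.
Qed.

Fact restr_is_linear A : linear (restr A).
Proof.
move=> c f h; apply/ffunP=> a; rewrite !ffunE.
by case: ifP => // _; rewrite scaler0 addr0.
Qed.

HB.instance Definition _ phi :=
  GRing.isLinear.Build K _ _ _ (coboundary phi) (coboundary_is_linear phi).
HB.instance Definition _ D :=
  GRing.isLinear.Build K _ _ _ (gl_act2 D) (gl_act2_is_linear D).
HB.instance Definition _ D :=
  GRing.isLinear.Build K _ _ _ (gl_act1 D) (gl_act1_is_linear D).
HB.instance Definition _ A :=
  GRing.isLinear.Build K _ _ _ (restr A) (restr_is_linear A).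

(* Zariski topology on M_n(K), used for identity components of subgroups
   of Gl_n(K) (which carries the induced topology). *)
Definition zariski_closed (Z : set 'M[K]_n) :=
  exists I : set {mpoly K[n * n]},
    Z = [set g | forall p, I p -> p.@[mxvec g 0] = 0].

Definition zariski_connected (C : set 'M[K]_n) :=
  forall Z1 Z2, zariski_closed Z1 -> zariski_closed Z2 ->
    C `<=` Z1 `|` Z2 -> C `&` (Z1 `&` Z2) = set0 -> C `<=` Z1 \/ C `<=` Z2.

Definition id_component (G : set 'M[K]_n) : set 'M[K]_n :=
  [set g | exists C, [/\ C `<=` G, zariski_connected C, C 1%:M & C g]].

End Bilinear.

Section Weights.
Variables (K : closedFieldType) (T : vectType K) (alpha : nat -> 'Hom(T, K^o)).

Section FixedDimension.
Variable n : nat.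
Implicit Types (phi psi : bilin K n) (A : {set midx n}).

Definition weight_mx (t : T) : 'M[K]_n := diag_mx (\row_i alpha i t).

Fact weight_mx_is_linear : linear weight_mx.
Proof.
move=> c t u; apply/matrixP=> i j; rewrite !mxE linearP /=.
by rewrite mulrnDl -mulrnAr.
Qed.

HB.instance Definition _ :=
  GRing.isLinear.Build K _ _ _ weight_mx weight_mx_is_linear.

(* image of T in gl_n(K) *)
Definition torus : {vspace 'M[K]_n} := limg (linfun weight_mx).

(* K-points of the scheme L_n^T *)
Definition lawsT : set (bilin K n) :=
  [set phi | lie_law phi /\ forall t, derivation phi (weight_mx t)].

Definition Sigma : set (bilin K n) :=
  [set phi | lawsT phi /\ maximal_torus phi torus].

Definition weight_idx : {set midx n} :=
  finset (fun a : midx n =>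
    (a.1.1 < a.1.2)%N && (alpha a.1.1 + alpha a.1.2 == alpha a.2)).

(* T-invariant cochains; by linearity in t it is enough to impose
   invariance under a basis of T. *)
Definition C1T : {vspace 'M[K]_n} :=
  (\bigcap_(t <- vbasis {:T}) lker (linfun (gl_act1 (weight_mx t))))%VS.
Definition invT2 : {vspace bilin K n} :=
  (\bigcap_(t <- vbasis {:T}) lker (linfun (gl_act2 (weight_mx t))))%VS.

Definition B2T phi : {vspace bilin K n} :=
  (limg (linfun (coboundary phi)) :&: invT2)%VS.

(* The rank of the linear forms L |-> (d_phi L)^a, a \in A, on C^1(K^n,K^n)^T
   is the dimension of the image of C^1(K^n,K^n)^T under all of them jointly. *)
Definition rank_forms phi A : nat :=
  \dim ((linfun (restr A) \o linfun (coboundary phi))%VF @: C1T).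

Definition admissible phi A : bool :=
  minset (fun B : {set midx n} =>
    (B \subset weight_idx) && (rank_forms phi B == \dim (B2T phi))) A.

Definition slice phi0 A : set (bilin K n) :=
  [set phi | lawsT phi /\ forall a, a \in A -> phi a = phi0 a].

Definition centralizerT : set 'M[K]_n :=
  [set g | g \in unitmx /\
           forall t, g *m weight_mx t = weight_mx t *m g].
Definition Gn : set 'M[K]_n := id_component centralizerT.

Definition normalizerT : set 'M[K]_n :=
  [set g | g \in unitmx /\
           [set g *m D *m invmx g | D in [set` torus]] = [set` torus]].

(* Gamma = H / H_0, as a set of left cosets *)
Definition Gamma : set (set 'M[K]_n) :=
  [set [set h *m g | g in id_component normalizerT] | h in normalizerT].

Definition Gn_orbit phi : set (bilin K n) := [set gact g phi | g in Gn].

Definition Gamma_act (c : set 'M[K]_n) (O : set (bilin K n)) :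
    set (bilin K n) :=
  [set gact h phi | h in c & phi in O].

(* the Gamma-orbits in Sigma_n(T) / G_n *)
Definition Gamma_orbits : set (set (set (bilin K n))) :=
  [set [set Gamma_act c (Gn_orbit phi) | c in Gamma] | phi in Sigma].

Definition trace (S : set (bilin K n)) (w : set (set (bilin K n))) :
    set (bilin K n) :=
  S `&` [set phi | w (Gn_orbit phi)].

Definition iso_classes (S : set (bilin K n)) : set (set (bilin K n)) :=
  [set S `&` isomorphic phi | phi in S].

End FixedDimension.

Record weight_path (n0 : nat) : Prop := WeightPath {
  path_span : <<[seq alpha i | i <- iota 0 n0]>>%VS = fullv;
  path_pos : exists t : T, forall i, (i < n0)%N ->
    exists2 q : rat, 0 < q & alpha i t = ratr q;
  path_Sigma : forall n, (n0 <= n)%N -> @Sigma n !=set0;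
  path_new : forall n, (n0 <= n)%N -> forall i j, (i < n)%N -> (j < n)%N ->
    alpha n <> alpha i - alpha j
}.

Definition simple_weight_path (n0 : nat) := weight_path n0 /\ injective alpha.

End Weights.

Arguments torus {K T} alpha n.
Arguments Sigma {K T} alpha n _.
Arguments lawsT {K T} alpha {n} _.
Arguments Gn {K T} alpha n _.
Arguments Gamma {K T} alpha n _.
Arguments Gamma_orbits {K T} alpha n _.

(* Main.v *)
From HB Require Import structures.
Require Import Defs.
From mathcomp Require Import all_boot all_order all_algebra closed_field.
From mathcomp Require Import all_classical.
From mathcomp Require Import mpoly.
Set Implicit Arguments.
Unset Strict Implicit.
Unset Printing Implicit Defensive.
Import GRing.Theory.
Local Open Scope ring_scope.
Local Open Scope classical_set_scope.

(** A set of weight relations is admissible exactly when it lies in the support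
    of the law and gives a basis of the linear forms [l_i + l_j - l_k] attached
    to that support; hence everything but part 3 is linear algebra, together with
    solving monomial equations over an algebraically closed field.

    Part 3 needs that an isomorphism between two laws having [T] as maximal torus
    can be chosen in the normalizer of [T].  The derivations of [psi] which an
    isomorphism [phi -> psi] carries to a diagonal matrix with distinct entries
    are Zariski dense among all derivations: such a [d] can be moved along any
    eigenvector of [ad d] by the exponential of a nilpotent derivation, so the
    ideal of functions vanishing there is stable under differentiation.  By
    quantifier elimination this set is constructible, so it contains a nonempty
    open set and meets the analogous set for the automorphisms of [psi].
    Comparing the two diagonalizations of a common element yields a monomial
    isomorphism. *)

(** Part 3 is an instance of conjugacy of maximal tori, carried out inside the vector space of
    derivations of [psi], where two nonempty open conditions always meet. Distinct weights make this
    work: the torus then contains a matrix with distinct diagonal entries, whose commutant is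
    diagonal and whose diagonalizations differ only by scaling and reordering of coordinates. The
    cardinality of [A] enters through a single dimension count: the forms attached to [A] then have
    exactly the image of [T] as common kernel, so every diagonal derivation of a law of the slice
    comes from [T]. The nonvanishing criterion, the maximality of [T] and the passage from a
    monomial isomorphism to the normalizer all rest on this. *)

(** * Polynomial functions, their derivatives, and a density criterion *)

Section PolynomialFunctions.
Variables (K : fieldType) (V : lmodType K).
Hypothesis charK0 : [pchar K] =i pred0.
Implicit Types (f g : V -> K) (x y v w : V).

(** Generating polynomial functions from linear forms avoids choosing a basis of [V] and lets
    derivatives be built by induction. *)
Inductive polyfun : (V -> K) -> Prop :=
| polyfun_cst c : polyfun (fun=> c)
| polyfun_lin (l : V -> K^o) : linear l -> polyfun l
| polyfun_add f g : polyfun f -> polyfun g -> polyfun (fun x => f x + g x)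
| polyfun_mul f g : polyfun f -> polyfun g -> polyfun (fun x => f x * g x).

Lemma polyfun_sum (I : Type) (r : seq I) (F : I -> V -> K) :
  (forall i, polyfun (F i)) -> polyfun (fun x => \sum_(i <- r) F i x).
Proof.
move=> PF; elim: r => [|i r IHr].
  have -> : (fun x => \sum_(i <- [::]) F i x) = fun=> 0.
    by apply/funext=> x; rewrite big_nil.
  exact: polyfun_cst.
have -> : (fun x => \sum_(j <- i :: r) F j x) =
          fun x => F i x + \sum_(j <- r) F j x.
  by apply/funext=> x; rewrite big_cons.
exact: polyfun_add.
Qed.

Lemma polyfun_prod (I : Type) (r : seq I) (F : I -> V -> K) :
  (forall i, polyfun (F i)) -> polyfun (fun x => \prod_(i <- r) F i x).
Proof.
move=> PF; elim: r => [|i r IHr].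
  have -> : (fun x => \prod_(i <- [::]) F i x) = fun=> 1.
    by apply/funext=> x; rewrite big_nil.
  exact: polyfun_cst.
have -> : (fun x => \prod_(j <- i :: r) F j x) =
          fun x => F i x * \prod_(j <- r) F j x.
  by apply/funext=> x; rewrite big_cons.
exact: polyfun_mul.
Qed.

Lemma polyfun_exp f k : polyfun f -> polyfun (fun x => f x ^+ k).
Proof.
move=> Pf; elim: k => [|k IHk]; first exact: polyfun_cst.
rewrite (_ : (fun x => _) = fun x => f x * f x ^+ k); first exact: polyfun_mul.
by apply/funext=> x; rewrite exprS.
Qed.

(** [D v] is the derivative in direction [v], characterized through restrictions to lines.
    Additivity in [v] later allows a direction to be split into eigenvectors. *)
Lemma polyfun_diff f : polyfun f ->
  exists D : V -> V -> K,
    [/\ forall v, polyfun (D v),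
        forall x v w, D (v + w) x = D v x + D w x
      & forall x v, exists q : {poly K}, forall c,
          f (x + c *: v) = q.[c] /\ D v (x + c *: v) = q^`().[c]].
Proof.
elim=> [c|l lin_l|{}f g _ [D [DP Da Dq]] _ [E [EP Ea Eq]]
       |{}f g Pf [D [DP Da Dq]] Pg [E [EP Ea Eq]]].
- exists (fun _ _ => 0); split=> [v|x v w|x v]; first exact: polyfun_cst.
    by rewrite addr0.
  by exists c%:P => a; rewrite derivC !hornerC.
- exists (fun v _ => l v); split=> [v|x v w|x v]; first exact: polyfun_cst.
    by rewrite -[v in l (v + _)]scale1r lin_l scale1r.
  exists ((l v)%:P * 'X + (l x)%:P) => c.
  rewrite !derivE !hornerE /=; split; first by rewrite addrC lin_l mulrC addrC.
  by rewrite ?(mul0r, mulr1, add0r, addr0).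
- exists (fun v x => D v x + E v x); split=> [v|x v w|x v].
  + exact: polyfun_add.
  + by rewrite Da Ea addrACA.
  have [q Hq] := Dq x v; have [r Hr] := Eq x v.
  exists (q + r) => c; have [-> ->] := Hq c; have [-> ->] := Hr c.
  by rewrite derivD !hornerE.
exists (fun v x => D v x * g x + f x * E v x); split=> [v|x v w|x v].
- by apply: polyfun_add; apply: polyfun_mul.
- by rewrite Da Ea mulrDl mulrDr addrACA.
have [q Hq] := Dq x v; have [r Hr] := Eq x v.
exists (q * r) => c; have [-> ->] := Hq c; have [-> ->] := Hr c.
by rewrite derivM !hornerE.
Qed.

Lemma polyfun_line f x v : polyfun f ->
  exists q : {poly K}, forall c, f (x + c *: v) = q.[c].
Proof.
case/polyfun_diff=> D [_ _ /(_ x v)[q Hq]].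
by exists q => c; case: (Hq c).
Qed.

Lemma natr_inj_char0 : injective (fun k : nat => k%:R : K).
Proof.
have natr0 k : (k%:R == 0 :> K) = (k == 0%N) by exact: (pcharf0P K).1.
have le_inj i j : (i <= j)%N -> i%:R = j%:R :> K -> i = j.
  move=> leij /esym/eqP; rewrite -subr_eq0 -natrB // natr0 subn_eq0 => leji.
  by apply/eqP; rewrite eqn_leq leij.
move=> i j /=; case/orP: (leq_total i j) => [/le_inj // | leji /esym Eij].
by apply/esym/le_inj.
Qed.

(** Multiplying [q] by the polynomial with root set [s] absorbs the exceptions; the integers then
    give more roots than the degree allows. *)
Lemma horner_cofinite_eq0 (q : {poly K}) (s : seq K) :
  (forall c, c \notin s -> q.[c] = 0) -> q = 0.
Proof.
move=> q0; pose r := q * \prod_(a <- s) ('X - a%:P).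
have nz_s : \prod_(a <- s) ('X - a%:P) != 0 by apply/monic_neq0/monic_prod_XsubC.
suff /eqP : r = 0 by rewrite mulf_eq0 (negPf nz_s) orbF => /eqP.
apply/eqP/negPn/negP=> nz_r.
pose rs := [seq (i%:R : K) | i <- iota 0 (size r)].
suff /(max_poly_roots nz_r) : all (root r) rs.
  rewrite map_inj_uniq; last exact: natr_inj_char0.
  by move/(_ (iota_uniq _ _)); rewrite size_map size_iota ltnn.
apply/allP=> c _; rewrite rootM root_prod_XsubC.
have [|/q0/eqP ?] := boolP (c \in s); first by rewrite orbT.
by rewrite orbF.
Qed.

Lemma deriv_eq0_const (q : {poly K}) : q^`() = 0 -> q = (q.[0])%:P.
Proof.
move=> dq0; have q0 i : q`_i.+1 = 0.
  have := congr1 (fun r : {poly K} => r`_i) dq0; rewrite coef_deriv coef0.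
  move/eqP; rewrite -mulr_natr mulf_eq0 ((pcharf0P K).1 charK0) orbF.
  by move/eqP.
by apply/polyP=> -[|i]; rewrite coefC horner_coef0 //= q0.
Qed.

Lemma polyfun_line_neq0 f g x v : polyfun f -> polyfun g ->
  (exists c, f (x + c *: v) != 0) -> (exists c, g (x + c *: v) != 0) ->
  exists c, f (x + c *: v) != 0 /\ g (x + c *: v) != 0.
Proof.
move=> /(polyfun_line x v)[q Hq] /(polyfun_line x v)[r Hr].
move=> [a fa] [b gb]; apply: contrapT => no_c.
have /eqP : q * r = 0.
  apply: (@horner_cofinite_eq0 _ [::]) => c _; rewrite hornerM -Hq -Hr.
  apply/eqP; rewrite mulf_eq0; apply/negPn/negP; rewrite negb_or => /andP[? ?].
  by apply: no_c; exists c.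
rewrite mulf_eq0 => /orP[] /eqP q0.
  by rewrite Hq q0 horner0 eqxx in fa.
by rewrite Hr q0 horner0 eqxx in gb.
Qed.

(** Join a point where the head is nonzero to one where the product of the tail is; on that line
    both are nonzero polynomials in one variable. *)
Lemma polyfun_neq0_common (I : eqType) (s : seq I) (F : I -> V -> K) :
  (forall i, polyfun (F i)) -> (forall i, i \in s -> exists x, F i x != 0) ->
  exists x, forall i, i \in s -> F i x != 0.
Proof.
move=> PF; elim: s => [|i s IHs] nzF; first by exists 0.
have [x nzx] := nzF i (mem_head _ _).
have [j sj|y nzy] := IHs; first by apply: nzF; rewrite inE sj orbT.
have [||c []] := polyfun_line_neq0 (x := x) (v := y - x) (PF i)
    (polyfun_prod s PF).
- by exists 0; rewrite scale0r addr0.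
- exists 1; rewrite scale1r addrC subrK prodf_seq_neq0.
  by apply/allP=> j /nzy.
move=> nzi; rewrite prodf_seq_neq0 => /allP nzs.
exists (x + c *: (y - x)) => j; rewrite inE => /predU1P[->//|/nzs].
by [].
Qed.

(* The ideal of functions vanishing on Y is stable under all directional
   derivatives along W, so on a line y + c v with y in Y their Taylor
   coefficients all vanish. *)
Lemma polyfun_dense (Y W : set V) :
  Y !=set0 -> (forall y v, Y y -> W v -> W (v - y)) ->
  (forall y v, Y y -> W v -> exists2 r : seq V, v = \sum_(u <- r) u
     & forall u, u \in r -> exists s : seq K, forall c,
         c \notin s -> Y (y + c *: u)) ->
  forall f, polyfun f -> (forall y, Y y -> f y = 0) -> forall v, W v -> f v = 0.
Proof.
move=> [y0 Yy0] WY tgt f Pf f0 v0 Wv0.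
(* Induction on a bound for [size q], with [f] quantified because the inductive step applies it to
   the derivative [D v]. *)
suff key k : forall f, polyfun f -> (forall y, Y y -> f y = 0) ->
    forall y v (q : {poly K}), Y y -> W v -> (size q <= k)%N ->
    (forall c, f (y + c *: v) = q.[c]) -> q = 0.
  have [q Hq] := polyfun_line y0 (v0 - y0) Pf.
  have := Hq 1; rewrite scale1r addrC subrK => ->.
  have WYv := WY _ _ Yy0 Wv0.
  by rewrite (key (size q) f Pf f0 y0 _ q Yy0 WYv (leqnn _) Hq) ?horner0.
elim: k => [|k IHk] {Pf f0}f Pf f0 y v q Yy Wv.
  by rewrite leqn0 size_poly_eq0 => /eqP.
move=> lt_qk Hq; have [D [PD Da HD]] := polyfun_diff Pf.
have D0 w : D 0 w = 0 by apply: (addrI (D 0 w)); rewrite -Da !addr0.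
have [r Hr] := HD y v.
have def_r : r = q.
  apply/eqP; rewrite -subr_eq0; apply/eqP/(@horner_cofinite_eq0 _ [::]) => c _.
  by rewrite hornerD hornerN -Hq; have [-> _] := Hr c; rewrite subrr.
have Dv0 : q^`() = 0.
  apply: (IHk (D v) (PD v) _ y v) => // [z Yz||c]; last 1 first.
  - by have [_ ->] := Hr c; rewrite def_r.
  (* [D v] vanishes on [Y]: along each summand [u] the line stays in [Y] for almost all scalars, so
     [f] is the zero polynomial there and so is its derivative. *)
  - have [s -> Ys] := tgt z v Yz Wv.
    elim: s Ys => [|u s IHs] Ys; first by rewrite big_nil.
    rewrite big_cons Da IHs ?addr0 => [|w sw]; last first.
      by apply: Ys; rewrite inE sw orbT.
    have [t Yt] := Ys u (mem_head _ _); have [p Hp] := HD z u.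
    have := Hp 0; rewrite scale0r addr0 => -[_ ->].
    rewrite (@horner_cofinite_eq0 p t) ?derivC ?horner0 // => c /Yt /f0.
    by have [->] := Hp c.
  have [->|nz_q] := eqVneq q 0; first by rewrite derivC size_poly0.
  by rewrite -ltnS; apply: leq_trans lt_qk; apply: lt_size_deriv.
rewrite (deriv_eq0_const Dv0) -Hq scale0r addr0 f0 //.
Qed.

End PolynomialFunctions.

(** * Properties holding on a nonempty open subset, and constructible sets *)

Section Generic.
Variables (K : fieldType) (V : lmodType K).
Hypothesis charK0 : [pchar K] =i pred0.
Implicit Types (W P Q : set V).

(** [P] contains a nonempty principal Zariski-open subset of [W]. *)
Definition generic W P := exists q : V -> K,
  [/\ polyfun q, exists2 v, W v & q v != 0
    & forall v, W v -> q v != 0 -> P v].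

Definition affine W := forall x y c, W x -> W y -> W (x + c *: (y - x)).

Lemma generic_all W P : W !=set0 -> (forall v, W v -> P v) -> generic W P.
Proof.
move=> [v Wv] WP; exists (fun=> 1); split=> [||w /WP //].
  exact: polyfun_cst.
by exists v; rewrite ?oner_eq0.
Qed.

Lemma generic_sub W P Q : generic W P -> (forall v, W v -> P v -> Q v) ->
  generic W Q.
Proof.
by move=> [q [Pq q0 qP]] PQ; exists q; split=> // v Wv /(qP _ Wv)/(PQ _ Wv).
Qed.

(** Irreducibility of an affine subspace: the line joining nonzeros of [q] and [r] stays in [W] and
    carries a common nonzero. *)
Lemma generic_and W P Q : affine W -> generic W P -> generic W Q ->
  generic W (fun v => P v /\ Q v).
Proof.
move=> affW [q [Pq [x Wx qx] qP]] [r [Pr [y Wy ry] rQ]].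
exists (fun v => q v * r v); split=> [||v Wv].
- exact: polyfun_mul.
- have [|| c [qc rc]] := polyfun_line_neq0 charK0 (x := x) (v := y - x) Pq Pr.
  + by exists 0; rewrite scale0r addr0.
  + by exists 1; rewrite scale1r addrC subrK.
  by exists (x + c *: (y - x)); [apply: affW | rewrite mulf_neq0].
by rewrite mulf_eq0 negb_or => /andP[/(qP _ Wv) ? /(rQ _ Wv)].
Qed.

Lemma generic_ex W P : generic W P -> exists2 v, W v & P v.
Proof. by move=> [q [_ [v Wv qv] qP]]; exists v => //; apply: qP. Qed.

(** Coordinates of a vector, read as values of the variables of a first-order formula. *)
Variable env : V -> seq K.
Hypothesis env_lin : forall i, linear ((fun v => (env v)`_i) : V -> K^o).

Lemma polyfun_rterm (t : GRing.term K) : GRing.rterm t ->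
  polyfun (fun v => GRing.eval (env v) t).
Proof.
elim: t => //= [i|c|k|t IHt u IHu|t IHt|t IHt k|t IHt u IHu|t IHt k].
- by move=> _; apply: (polyfun_lin (env_lin i)).
- by move=> _; apply: polyfun_cst.
- by move=> _; apply: polyfun_cst.
- by case/andP=> /IHt ? /IHu; apply: polyfun_add.
- move/IHt=> Pt; rewrite (_ : (fun v => _) =
    fun v => (-1) * GRing.eval (env v) t); last first.
    by apply/funext=> v; rewrite mulN1r.
  by apply: polyfun_mul => //; apply: polyfun_cst.
- move/IHt=> Pt; rewrite (_ : (fun v => _) =
    fun v => k%:R * GRing.eval (env v) t); last first.
    by apply/funext=> v; rewrite mulr_natl.
  by apply: polyfun_mul => //; apply: polyfun_cst.
- by case/andP=> /IHt ? /IHu; apply: polyfun_mul.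
by move/IHt; apply: polyfun_exp.
Qed.

Lemma generic_qf W (f : GRing.formula K) : affine W -> W !=set0 ->
  GRing.qf_form f && GRing.rformula f ->
  generic W (fun v => GRing.holds (env v) f) \/
  generic W (fun v => ~ GRing.holds (env v) f).
Proof.
move=> affW W0; elim: f => //= [b|t u|f IHf g IHg|f IHf g IHg|f IHf g IHg|f IHf].
- by case: b => _; [left | right]; apply: generic_all.
- case/andP=> rt ru; have Ptu := polyfun_rterm (t := GRing.Add t (GRing.Opp u)).
  have {Ptu} := Ptu _; rewrite /= rt ru => /(_ isT) Ptu.
  have [tu0|] := pselect (forall v, W v ->
    GRing.eval (env v) t - GRing.eval (env v) u = 0).
    by left; apply: generic_all => // v Wv; apply/eqP; rewrite -subr_eq0 tu0.
  move=> /existsNP[v /not_implyP[Wv /eqP nz_v]]; right.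
  exists (fun v => GRing.eval (env v) t - GRing.eval (env v) u); split=> //.
    by exists v.
  by move=> w _; rewrite subr_eq0 => /eqP.
- rewrite andbACA => /andP[/IHf[Gf|Gf] /IHg[Gg|Gg]].
  + by left; apply: generic_and.
  + by right; apply: generic_sub Gg _ => v _ ? [].
  + by right; apply: generic_sub Gf _ => v _ ? [].
  + by right; apply: generic_sub Gf _ => v _ ? [].
- rewrite andbACA => /andP[/IHf[Gf|Gf] /IHg[Gg|Gg]].
  + by left; apply: generic_sub Gf _; left.
  + by left; apply: generic_sub Gf _; left.
  + by left; apply: generic_sub Gg _; right.
  + by right; apply: generic_sub (generic_and affW Gf Gg) _ => v _ [? ?] [].
- rewrite andbACA => /andP[/IHf[Gf|Gf] /IHg[Gg|Gg]].
  + by left; apply: generic_sub Gg _.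
  + by right; apply: generic_sub (generic_and affW Gf Gg) _ => v _ [Pf nPg] /(_ Pf).
  + by left; apply: generic_sub Gg _.
  + by left; apply: generic_sub Gf _ => v _ ? ?.
- by case/IHf=> Gf; [right | left]; apply: generic_sub Gf _ => v _ Pv // /(_ Pv).
Qed.

Lemma generic_dense W P (f : GRing.formula K) : affine W -> W !=set0 ->
  GRing.qf_form f && GRing.rformula f ->
  (forall v, GRing.holds (env v) f <-> P v) ->
  (forall q, polyfun q -> (forall v, P v -> q v = 0) ->
     forall v, W v -> q v = 0) ->
  (forall v, P v -> W v) -> generic W P.
Proof.
move=> affW W0 wf_f fP denseP PW.
have [Gf|[q [Pq [v Wv nz_q] qf]]] := generic_qf affW W0 wf_f.
  by apply: generic_sub Gf _ => v _ /fP.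
(* In the other case [q] vanishes on [P] without vanishing on [W], against density. *)
case/eqP: nz_q; apply: (denseP q Pq) => // w Pw.
by apply/eqP/negPn/negP=> /(qf _ (PW _ Pw)); rewrite fP.
Qed.

End Generic.

(** * First-order definable sets and quantifier elimination *)

Section Definable.
Variable K : closedFieldType.
Implicit Types (f g : seq K -> K) (S R : set (seq K)).

Definition termfun f :=
  exists2 t : GRing.term K, GRing.rterm t & forall e, GRing.eval e t = f e.

Definition definable S :=
  exists2 f : GRing.formula K, GRing.rformula f
    & forall e, GRing.holds e f <-> S e.

Lemma termfun_var i : termfun (fun e => e`_i).
Proof. by exists (GRing.Var K i). Qed.

Lemma termfun_cst c : termfun (fun=> c).
Proof. by exists (GRing.Const c). Qed.

Lemma termfun_add f g : termfun f -> termfun g -> termfun (fun e => f e + g e).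
Proof.
move=> [t rt Et] [u ru Eu]; exists (GRing.Add t u); rewrite /= ?rt //.
by move=> e; rewrite Et Eu.
Qed.

Lemma termfun_mul f g : termfun f -> termfun g -> termfun (fun e => f e * g e).
Proof.
move=> [t rt Et] [u ru Eu]; exists (GRing.Mul t u); rewrite /= ?rt //.
by move=> e; rewrite Et Eu.
Qed.

Lemma termfun_sum (I : Type) (r : seq I) (F : I -> seq K -> K) :
  (forall i, termfun (F i)) -> termfun (fun e => \sum_(i <- r) F i e).
Proof.
move=> tF; elim: r => [|i r IHr].
  rewrite (_ : (fun e => _) = fun=> 0); first exact: termfun_cst.
  by apply/funext=> e; rewrite big_nil.
rewrite (_ : (fun e => _) = fun e => F i e + \sum_(j <- r) F j e).
  exact: termfun_add.
by apply/funext=> e; rewrite big_cons.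
Qed.

Lemma definable_eq f g : termfun f -> termfun g -> definable (fun e => f e = g e).
Proof.
move=> [t rt Et] [u ru Eu]; exists (GRing.Equal t u); rewrite /= ?rt //.
by move=> e; rewrite Et Eu.
Qed.

Lemma definable_not S : definable S -> definable (fun e => ~ S e).
Proof.
by move=> [f rf Ef]; exists (GRing.Not f) => //= e; rewrite Ef.
Qed.

Lemma definable_and S R : definable S -> definable R ->
  definable (fun e => S e /\ R e).
Proof.
move=> [f rf Ef] [g rg Eg]; exists (GRing.And f g) => [|e] /=.
  by rewrite rf.
by rewrite Ef Eg.
Qed.

Lemma definable_forall (I : finType) (F : I -> set (seq K)) :
  (forall i, definable (F i)) -> definable (fun e => forall i, F i e).
Proof.
move=> dF; suff dr (r : seq I) :
    definable (fun e => forall i, i \in r -> F i e).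
  have [f rf Ef] := dr (enum I); exists f => // e; rewrite Ef.
  by split=> Fe i => [|_]; apply: Fe; rewrite ?mem_enum.
elim: r => [|i r [f rf Ef]]; first by exists (GRing.Bool true).
have [g rg Eg] := dF i; exists (GRing.And g f) => [|e] /=; first by rewrite rg.
rewrite Eg Ef; split=> [[Fi Fr] j | Fr].
  by rewrite inE => /predU1P[-> // | /Fr].
by split=> [|j rj]; apply: Fr; rewrite inE ?eqxx ?rj ?orbT.
Qed.

(** Projections of constructible sets are constructible; the variables in [I] are those projected
    away. *)
Lemma definable_qf S (I : seq nat) : definable S ->
  exists2 f : GRing.formula K, GRing.qf_form f && GRing.rformula f
    & forall e, GRing.holds e f <->
        exists2 e', {in [predC I], GRing.same_env e e'} & S e'.
Proof.
move=> [f rf Ef]; pose F := foldr GRing.Exists f I.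
have rF : GRing.rformula F by rewrite /F; elim: (I).
have wfe := @ClosedFieldQE.wf_ex_elim K.
have oke := ClosedFieldQE.holds_ex_elim (@GRing.solve_monicpoly K).
have wfF := GRing.quantifier_elim_wf wfe rF.
exists (GRing.quantifier_elim (@ClosedFieldQE.ex_elim K) F) => // e.
have /andP[qfF _] := wfF; split.
  move/(GRing.qf_evalP e qfF)/(GRing.quantifier_elim_rformP wfe oke e rF).
  by case/GRing.foldExistsP=> e' eq_e /Ef; exists e'.
case=> e' eq_e /Ef Se'; apply: (elimT (GRing.qf_evalP e qfF)).
apply: (introT (GRing.quantifier_elim_rformP wfe oke e rF)).
by apply: (GRing.foldExistsP f I e).1; exists e'.
Qed.

End Definable.

(** * Brackets, derivations and isomorphisms in coordinates *)

Section Brackets.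
Variables (K : closedFieldType) (n : nat).
Implicit Types (phi psi chi : bilin K n) (D g h : 'M[K]_n) (x y : 'cV[K]_n).

Lemma col_sum_delta x : x = \sum_i x i 0 *: delta_mx i 0.
Proof.
by rewrite [LHS]matrix_sum_delta; apply: eq_bigr => i _; rewrite big_ord1.
Qed.

Lemma linear_colE (f : 'cV[K]_n -> 'cV[K]_n) x : linear f ->
  f x = \sum_i x i 0 *: f (delta_mx i 0).
Proof.
move=> lin_f; pose fl : {linear 'cV[K]_n -> 'cV[K]_n} :=
  HB.pack f (GRing.isLinear.Build K _ _ _ f lin_f).
rewrite {1}(col_sum_delta x) -[f]/(fl : _ -> _) linear_sum.
by apply: eq_bigr => i _; rewrite linearZ.
Qed.

Lemma bracketZl phi c x y : bracket phi (c *: x) y = c *: bracket phi x y.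
Proof.
apply/matrixP=> k l; rewrite !mxE mulr_sumr; apply: eq_bigr => i _.
by rewrite mulr_sumr; apply: eq_bigr => j _; rewrite mxE !mulrA.
Qed.

Lemma bracketZr phi c x y : bracket phi x (c *: y) = c *: bracket phi x y.
Proof.
apply/matrixP=> k l; rewrite !mxE mulr_sumr; apply: eq_bigr => i _.
by rewrite mulr_sumr; apply: eq_bigr => j _; rewrite mxE !mulrA (mulrC c).
Qed.

Lemma bracket0l phi y : bracket phi 0 y = 0.
Proof. by have := bracketZl phi 0 0 y; rewrite !scale0r. Qed.

Lemma bracket0r phi x : bracket phi x 0 = 0.
Proof. by have := bracketZr phi 0 x 0; rewrite !scale0r. Qed.

Lemma bracket_suml phi (I : finType) (F : I -> 'cV[K]_n) y :
  bracket phi (\sum_i F i) y = \sum_i bracket phi (F i) y.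
Proof.
apply: (big_morph (fun u => bracket phi u y)) => [u w|]; last exact: bracket0l.
by have := bracket_linearl phi y 1 u w; rewrite !scale1r.
Qed.

Lemma bracket_sumr phi (I : finType) (F : I -> 'cV[K]_n) x :
  bracket phi x (\sum_i F i) = \sum_i bracket phi x (F i).
Proof.
apply: (big_morph (bracket phi x)) => [u w|]; last exact: bracket0r.
by have := bracket_linearr phi x 1 u w; rewrite !scale1r.
Qed.

Lemma bracket_delta phi i j k :
  bracket phi (delta_mx i 0) (delta_mx j 0) k 0 = phi (i, j, k).
Proof.
rewrite mxE (bigD1 i) //= (bigD1 j) //= !mxE !eqxx !mul1r.
rewrite big1 ?addr0 => [|l /negPf nlj]; last by rewrite mxE nlj mulr0 mul0r.
rewrite big1 ?addr0 // => l /negPf nli; rewrite big1 // => m _.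
by rewrite !mxE nli !mul0r.
Qed.

Lemma bracket_sconst f x y :
  (forall y, linear (f^~ y)) -> (forall x, linear (f x)) ->
  bracket (sconst f) x y = f x y.
Proof.
move=> linl linr; rewrite (linear_colE x (linl y)).
apply/matrixP=> k l; rewrite ord1 mxE summxE; apply: eq_bigr => i _.
rewrite mxE (linear_colE y (linr _)) summxE mulr_sumr; apply: eq_bigr => j _.
by rewrite ffunE !mxE mulrA.
Qed.

Lemma bilinear_ext (f h : 'cV[K]_n -> 'cV[K]_n -> 'cV[K]_n) :
  (forall y, linear (f^~ y)) -> (forall x, linear (f x)) ->
  (forall y, linear (h^~ y)) -> (forall x, linear (h x)) ->
  (forall i j k, f (delta_mx i 0) (delta_mx j 0) k 0 =
                 h (delta_mx i 0) (delta_mx j 0) k 0) ->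
  forall x y, f x y = h x y.
Proof.
move=> fl fr hl hr Efh x y; rewrite -(bracket_sconst x y fl fr).
rewrite -(bracket_sconst x y hl hr); congr (bracket _ x y).
by apply/ffunP=> -[[i j] k]; rewrite !ffunE Efh.
Qed.

Lemma mulmx_bracket_linearl phi D g h y :
  linear (fun x => D *m bracket phi (g *m x) (h *m y)).
Proof.
by move=> c u v; rewrite mulmxDr -scalemxAr bracket_linearl mulmxDr -scalemxAr.
Qed.

Lemma mulmx_bracket_linearr phi D g h x :
  linear (fun y => D *m bracket phi (g *m x) (h *m y)).
Proof.
by move=> c u v; rewrite mulmxDr -scalemxAr bracket_linearr mulmxDr -scalemxAr.
Qed.

Lemma linear_add (U V : lmodType K) (f h : U -> V) :
  linear f -> linear h -> linear (fun u => f u + h u).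
Proof. by move=> lf lh c u v; rewrite lf lh scalerDr addrACA. Qed.

Lemma mulmx_delta (m : nat) (M : 'M[K]_(m, n)) i k :
  (M *m delta_mx i 0 : 'cV_m) k 0 = M k i.
Proof. by rewrite -colE mxE. Qed.

Lemma bracket_mulmx_deltal phi D i j k :
  bracket phi (D *m delta_mx i 0) (delta_mx j 0) k 0 =
  \sum_l D l i * phi (l, j, k).
Proof.
rewrite (linear_colE (D *m _) (bracket_linearl phi (delta_mx j 0))) summxE.
by apply: eq_bigr => l _; rewrite mxE bracket_delta mulmx_delta.
Qed.

Lemma bracket_mulmx_deltar phi D i j k :
  bracket phi (delta_mx i 0) (D *m delta_mx j 0) k 0 =
  \sum_l D l j * phi (i, l, k).
Proof.
rewrite (linear_colE (D *m _) (bracket_linearr phi (delta_mx i 0))) summxE.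
by apply: eq_bigr => l _; rewrite mxE bracket_delta mulmx_delta.
Qed.

Lemma mulmx_bracket_delta phi D i j k :
  (D *m bracket phi (delta_mx i 0) (delta_mx j 0)) k 0 =
  \sum_l D k l * phi (i, j, l).
Proof. by rewrite mxE; apply: eq_bigr => l _; rewrite bracket_delta. Qed.

(** Bilinearity reduces the condition to basis vectors, giving linear equations in the entries of
    [D] that a formula can express. *)
Lemma derivationE phi D : derivation phi D <-> forall i j k,
  \sum_l D k l * phi (i, j, l) =
  \sum_l D l i * phi (l, j, k) + \sum_l D l j * phi (i, l, k).
Proof.
split=> [dD i j k|dD].
  by rewrite -mulmx_bracket_delta dD mxE bracket_mulmx_deltal bracket_mulmx_deltar.
have ml g h y : linear (fun x => bracket phi (g *m x) (h *m y)).
  by move=> c u v; have := mulmx_bracket_linearl phi 1%:M g h y c u v; rewrite !mul1mx.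
have mr g h x : linear (fun y => bracket phi (g *m x) (h *m y)).
  by move=> c u v; have := mulmx_bracket_linearr phi 1%:M g h x c u v; rewrite !mul1mx.
have E := @bilinear_ext (fun x y => D *m bracket phi (1%:M *m x) (1%:M *m y))
  (fun x y => bracket phi (D *m x) (1%:M *m y) + bracket phi (1%:M *m x) (D *m y)).
move=> x y; have := E _ _ _ _ _ x y; rewrite !mul1mx; apply.
- exact: mulmx_bracket_linearl.
- exact: mulmx_bracket_linearr.
- by move=> z; apply: linear_add; apply: ml.
- by move=> z; apply: linear_add; apply: mr.
by move=> i j k; rewrite !mul1mx mulmx_bracket_delta mxE
  bracket_mulmx_deltal bracket_mulmx_deltar.
Qed.

(** Intertwining form of [isomorphic]: apart from invertibility it is polynomial in [g], as [isomE]
    shows. *)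
Definition isom chi psi g := g \in unitmx /\
  forall x y, g *m bracket chi x y = bracket psi (g *m x) (g *m y).

Lemma isomE chi psi g : isom chi psi g <-> g \in unitmx /\ forall i j k,
  \sum_l g k l * chi (i, j, l) = \sum_p \sum_q g p i * g q j * psi (p, q, k).
Proof.
have rhs i j k : bracket psi (g *m delta_mx i 0) (g *m delta_mx j 0) k 0 =
    \sum_p \sum_q g p i * g q j * psi (p, q, k).
  by rewrite mxE; apply: eq_bigr => p _; apply: eq_bigr => q _; rewrite !mulmx_delta.
split=> -[Ug gP]; split=> //; first by move=> i j k; rewrite -mulmx_bracket_delta gP rhs.
move=> x y.
have := @bilinear_ext (fun x y => g *m bracket chi (1%:M *m x) (1%:M *m y))
  (fun x y => 1%:M *m bracket psi (g *m x) (g *m y)) _ _ _ _ _ x y.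
rewrite !mul1mx; apply; try by move=> z; first
  [exact: mulmx_bracket_linearl | exact: mulmx_bracket_linearr].
by move=> i j k; rewrite !mul1mx mulmx_bracket_delta gP rhs.
Qed.

Lemma isom_gact phi g : g \in unitmx -> isom phi (gact g phi) g.
Proof.
move=> Ug; split=> // x y; rewrite bracket_sconst ?mulKmx // => z.
  exact: mulmx_bracket_linearl.
exact: mulmx_bracket_linearr.
Qed.

Lemma isom_gactE phi psi g : isom phi psi g -> psi = gact g phi.
Proof.
case=> Ug gP; apply/ffunP=> -[[i j] k]; rewrite ffunE /= gP !mulKVmx //.
by rewrite bracket_delta.
Qed.

Lemma isomorphicP phi psi : isomorphic phi psi <-> exists g, isom phi psi g.
Proof.
split=> [[g Ug ->]|[g gP]]; first by exists g; apply: isom_gact.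
by exists g; [case: gP | apply: isom_gactE].
Qed.

Lemma invmxM g h : g \in unitmx -> h \in unitmx ->
  invmx (g *m h) = invmx h *m invmx g.
Proof.
move=> Ug Uh; have Ugh : g *m h \in unitmx by rewrite unitmx_mul Ug.
rewrite -[RHS]mul1mx -(mulVmx Ugh) -mulmxA -(mulmxA g) mulKVmx //.
by rewrite mulmxV // mulmx1.
Qed.

Lemma isom1 phi : isom phi phi 1%:M.
Proof. by split=> [|x y]; rewrite ?unitmx1 ?mul1mx. Qed.

Lemma isomM phi psi chi g h :
  isom phi psi g -> isom psi chi h -> isom phi chi (h *m g).
Proof.
move=> [Ug gP] [Uh hP]; split=> [|x y]; first by rewrite unitmx_mul Uh.
by rewrite -!mulmxA gP hP.
Qed.

Lemma isomV phi psi g : isom phi psi g -> isom psi phi (invmx g).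
Proof.
move=> [Ug gP]; split=> [|x y]; first by rewrite unitmx_inv.
by rewrite -[RHS](mulKmx Ug) gP !mulKVmx.
Qed.

Lemma gactM phi g h : g \in unitmx -> h \in unitmx ->
  gact h (gact g phi) = gact (h *m g) phi.
Proof. by move=> Ug Uh; apply: isom_gactE; apply: isomM; apply: isom_gact. Qed.

Lemma gact1 phi : gact 1%:M phi = phi.
Proof. by rewrite -(isom_gactE (isom1 phi)). Qed.

Lemma derivation_conj phi psi g D : isom phi psi g -> derivation phi D ->
  derivation psi (g *m D *m invmx g).
Proof.
move=> gP dD x y; have [Ug gE] := gP; have [_ gE'] := isomV gP.
rewrite -!mulmxA gE' dD mulmxDr !gE !mulmxA.
by rewrite !mulmxV // !mul1mx.
Qed.

Lemma derivation_linear phi c D E : derivation phi D -> derivation phi E ->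
  derivation phi (c *: D + E).
Proof.
move=> dD dE x y; rewrite !mulmxDl -!scalemxAl bracket_linearl bracket_linearr.
by rewrite dD dE scalerDr addrACA.
Qed.

Lemma derivation0 phi : derivation phi 0.
Proof.
by apply/derivationE => i j k; rewrite !big1 ?addr0 // => l _; rewrite mxE mul0r.
Qed.

Lemma derivation_diag phi (d : 'rV[K]_n) : derivation phi (diag_mx d) <->
  forall i j k, phi (i, j, k) != 0 -> d 0 i + d 0 j = d 0 k.
Proof.
have E i j k : (\sum_l diag_mx d k l * phi (i, j, l) =
  \sum_l diag_mx d l i * phi (l, j, k) + \sum_l diag_mx d l j * phi (i, l, k))
  <-> (d 0 i + d 0 j - d 0 k) * phi (i, j, k) = 0.
  rewrite (bigD1 k) //= (bigD1 i (P := predT)) //= (bigD1 j (P := predT)) //=.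
  rewrite !big1 ?addr0 => [|l /negPf nl|l /negPf nl|l /negPf nl];
    try by rewrite mxE ?nl 1?eq_sym ?nl mul0r.
  rewrite !mxE !eqxx !mulr1n mulrBl mulrDl; split=> [->|/eqP].
    by rewrite subrr.
  by rewrite subr_eq0 => /eqP->.
split=> [/derivationE dd i j k nz|dd].
  have /E/eqP := dd i j k; rewrite mulf_eq0 (negPf nz) orbF subr_eq0.
  by move/eqP.
apply/derivationE=> i j k; apply/E.
have [->|/dd->] := eqVneq (phi (i, j, k)) 0; first by rewrite mulr0.
by rewrite subrr mul0r.
Qed.

End Brackets.

(** * Exponentials of nilpotent derivations *)

Section NilpotentExponential.
Variables (K : closedFieldType) (n : nat).
Hypothesis charK0 : [pchar K] =i pred0.
Implicit Types (phi : bilin K n) (x : 'M[K]_n) (a b : 'cV[K]_n).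

Definition divpow x k : 'M[K]_n := (k`!%:R)^-1 *: x ^+ k.

(** Truncated exponential series; it is the full exponential once [x ^+ m = 0]. *)
Definition mxexp x m : 'M[K]_n := \sum_(k < m) divpow x k.

Lemma natr_eq0_char0 k : (k%:R == 0 :> K) = (k == 0%N).
Proof. exact: (pcharf0P K).1. Qed.

Lemma mul_divpow x k : x *m divpow x k = k.+1%:R *: divpow x k.+1.
Proof.
rewrite -scalemxAr scalerA factS natrM invfM mulrA.
by rewrite divff ?natr_eq0_char0 // mul1r exprS.
Qed.

Lemma divpow_eq0 x m k : x ^+ m = 0 -> (m <= k)%N -> divpow x k = 0.
Proof. by move=> xm0 /subnK <-; rewrite /divpow exprD xm0 mulr0 scaler0. Qed.

(** Leibniz rule; divided powers absorb the binomial coefficients. *)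
Lemma divpow_derivation phi x k a b : derivation phi x ->
  divpow x k *m bracket phi a b =
  \sum_(i < k.+1) bracket phi (divpow x i *m a) (divpow x (k - i) *m b).
Proof.
move=> dx; elim: k => [|k IHk].
  by rewrite big_ord1 /divpow fact0 invr1 !expr0 !scale1r !mul1mx.
have nz_k : k.+1%:R != 0 :> K by rewrite natr_eq0_char0.
apply: (scalerI nz_k); rewrite scalemxAl -mul_divpow -mulmxA IHk mulmx_sumr.
pose T i := bracket phi (divpow x i *m a) (divpow x (k.+1 - i) *m b).
(* Split the factor [k.+1] as [i + (k.+1 - i)]; the two halves match the two terms produced by one
   more application of [x]. *)
have -> : k.+1%:R *: \sum_(i < k.+2) T i =
    \sum_(i < k.+2) i%:R *: T i + \sum_(i < k.+2) (k.+1 - i)%:R *: T i.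
  rewrite -big_split scaler_sumr; apply: eq_bigr => i _ /=.
  by rewrite -scalerDl -natrD subnKC // -ltnS.
have -> : \sum_(i < k.+2) i%:R *: T i = \sum_(i < k.+1) i.+1%:R *: T i.+1.
  by rewrite big_ord_recl /= mulr0n scale0r add0r.
have -> : \sum_(i < k.+2) (k.+1 - i)%:R *: T i =
    \sum_(i < k.+1) (k.+1 - i)%:R *: T i.
  by rewrite big_ord_recr /= subnn mulr0n scale0r addr0.
rewrite -big_split; apply: eq_bigr => i _ /=.
have le_ik : (i <= k)%N by rewrite -ltnS.
rewrite dx !mulmxA !mul_divpow -(scalemxAl i.+1%:R) -(scalemxAl (k - i).+1%:R).
rewrite bracketZl bracketZr.
by rewrite /T subSS subSn.
Qed.

Lemma sum_antidiag (M : zmodType) (F : nat -> nat -> M) m :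
  \sum_(k < m) \sum_(i < k.+1) F i (k - i)%N =
  \sum_(i < m) \sum_(j < m - i) F i j.
Proof.
elim: m => [|m IHm]; first by rewrite !big_ord0.
rewrite big_ord_recr IHm /= [RHS]big_ord_recr /= subSnn big_ord1.
rewrite [X in _ + X]big_ord_recr /= subnn addrA -big_split; congr (_ + _).
by apply: eq_bigr => i _ /=; rewrite subSn 1?ltnW // big_ord_recr.
Qed.

Lemma sum_ord_trunc (M : zmodType) (F : nat -> M) p m : (p <= m)%N ->
  (forall i, (p <= i)%N -> F i = 0) -> \sum_(i < m) F i = \sum_(i < p) F i.
Proof.
move=> le_pm F0; rewrite -!(big_mkord predT) (big_cat_nat (leq0n p) le_pm) //=.
rewrite [X in _ + X]big_nat_cond [X in _ + X]big1 ?addr0 //.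
by move=> i /andP[/andP[/F0]].
Qed.

Lemma mxexp_trunc x p m : x ^+ p = 0 -> (p <= m)%N -> mxexp x m = mxexp x p.
Proof.
move=> xp0 le_pm; apply: (sum_ord_trunc le_pm) => i; exact: divpow_eq0.
Qed.

Lemma mxexp_bracket phi x m a b : derivation phi x -> x ^+ m = 0 ->
  mxexp x m *m bracket phi a b = bracket phi (mxexp x m *m a) (mxexp x m *m b).
Proof.
move=> dx xm0.
(* With length [m + m] the antidiagonals cover the whole square [i, j < m], and outside it one
   factor is zero. *)
rewrite -[in LHS](@mxexp_trunc x m (m + m)) ?leq_addr //.
rewrite /mxexp !mulmx_suml; under eq_bigr do rewrite (divpow_derivation _ _ _ dx).
pose F i j := bracket phi (divpow x i *m a) (divpow x j *m b).
rewrite (sum_antidiag F) (@sum_ord_trunc _ (fun i => \sum_(j < m + m - i) F i j) m).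
- rewrite bracket_suml; apply: eq_bigr => i _; rewrite bracket_sumr.
  apply: (@sum_ord_trunc _ (F i)) => [|j le_mj].
    by rewrite -addnBA ?leq_addr // ltnW.
  by rewrite /F (divpow_eq0 xm0 le_mj) mul0mx bracket0r.
- exact: leq_addr.
move=> i le_mi; rewrite big1 // => j _.
by rewrite /F (divpow_eq0 xm0 le_mi) mul0mx bracket0l.
Qed.

(** The exponential is [1 + x * w] with [x] and [w] commuting, so [x * w] is nilpotent and a finite
    geometric series gives the inverse. *)
Lemma mxexp_unit x m : x ^+ m = 0 -> mxexp x m \in unitmx.
Proof.
move=> xm0; rewrite -(@mxexp_trunc x m m.+1) //.
rewrite /mxexp big_ord_recl /divpow fact0 invr1 expr0 scale1r.
pose w := \sum_(k < m) (k.+1`!%:R)^-1 *: x ^+ k.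
have -> : \sum_(k < m) ((lift ord0 k)`!%:R)^-1 *: x ^+ lift ord0 k = x * w.
  rewrite mulr_sumr; apply: eq_bigr => k _; rewrite -[x * _]scalemxAr.
  by rewrite -[x *m _]exprS.
have cxw : GRing.comm x w.
  apply: commr_sum => k _; rewrite /GRing.comm -[x * _]scalemxAr -[_ * x]scalemxAl.
  by rewrite -[x *m _]exprS -[_ *m x]exprSr.
pose z := - (x * w); have z0 : z ^+ m = 0.
  by rewrite exprNn exprMn_comm // xm0 mul0r mulr0.
have [] // : 1%:M + x * w \in unitmx /\ (\sum_(i < m) z ^+ i) \in unitmx.
apply: mulmx1_unit; have := subrX1 z m; rewrite z0 sub0r /z => /(congr1 -%R).
rewrite opprK -mulNr opprB opprK => E.
exact/esym/E.
Qed.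

(** For an eigenvector [y] of [ad d], the bracket of [d] with [y] commutes with [y], so conjugating
    [d] by the exponential stops after the linear term. *)
Lemma mxexp_conj (d y : 'M[K]_n) (b : K) m : d *m y - y *m d = b *: y -> y ^+ m = 0 ->
  mxexp y m *m d = (d - b *: y) *m mxexp y m.
Proof.
move=> dy ym0.
have yd k : y ^+ k *m d = d *m y ^+ k - (k%:R * b) *: y ^+ k.
  elim: k => [|k IHk]; first by rewrite mul0r scale0r subr0 mul1mx mulmx1.
  rewrite exprSr -[y ^+ k * y]/(y ^+ k *m y) -mulmxA.
  have -> : y *m d = d *m y - b *: y by rewrite -dy opprB addrC subrK.
  rewrite mulmxBr (mulmxA _ d y) IHk mulmxBl -scalemxAl -scalemxAr -mulmxA.
  by rewrite -addrA -opprD -scalerDl -natr1 mulrDl mul1r.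
rewrite mulmxBl -scalemxAl /mxexp mulmx_suml !mulmx_sumr.
have -> : \sum_(i < m) y *m divpow y i = \sum_(i < m) i%:R *: divpow y i.
  case: m ym0 => [|m ym0]; first by rewrite !big_ord0.
  rewrite big_ord_recr [RHS]big_ord_recl /= mulr0n scale0r add0r mul_divpow.
  rewrite (divpow_eq0 ym0) // scaler0 addr0; apply: eq_bigr => i _.
  exact: mul_divpow.
rewrite scaler_sumr -sumrB; apply: eq_bigr => i _.
rewrite /divpow -scalemxAl yd scalerBr scalemxAr !scalerA; congr (_ - _ *: _).
by rewrite mulrC (mulrC b).
Qed.

End NilpotentExponential.

(** * Density of the derivations that an isomorphism diagonalizes with distinct entries *)

Section RegularDerivations.
Variables (K : closedFieldType) (n : nat).
Hypothesis charK0 : [pchar K] =i pred0.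
Implicit Types (phi psi chi : bilin K n) (d : 'rV[K]_n) (x D g : 'M[K]_n).
Implicit Types (b : K).

(** Component of [x] in the eigenspace of [ad (diag_mx d)] for the eigenvalue [b]. *)
Definition adcomp d b x : 'M[K]_n :=
  \matrix_(i, j) if d 0 i - d 0 j == b then x i j else 0.

(** In the equation of [derivationE] at [(i, j, k)], the entries of [x] with nonzero coefficient all
    have weight [d 0 k - d 0 i - d 0 j], so the equation holds weight by weight. *)
Lemma derivation_adcomp chi d b x :
  derivation chi (diag_mx d) -> derivation chi x -> derivation chi (adcomp d b x).
Proof.
move=> /derivation_diag dd /derivationE dx; apply/derivationE=> i j k.
have sumE c (t : 'I_n -> K) (a w : 'I_n -> K) :
    (forall l, w l != 0 -> t l = c) ->
    \sum_l (if t l == b then a l else 0) * w l =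
    if c == b then \sum_l a l * w l else 0.
  move=> tc; have -> : (if c == b then \sum_l a l * w l else 0) =
      \sum_l if c == b then a l * w l else 0 by case: ifP => // _; rewrite big1.
  apply: eq_bigr => l _.
  have [->|/tc->] := eqVneq (w l) 0; first by rewrite !mulr0 if_same.
  by case: ifP; rewrite ?mul0r.
under eq_bigr do rewrite mxE.
under [X in _ = X + _]eq_bigr do rewrite mxE.
under [X in _ = _ + X]eq_bigr do rewrite mxE.
have E1 l : chi (i, j, l) != 0 -> d 0 k - d 0 l = d 0 k - d 0 i - d 0 j.
  by move/dd=> <-; rewrite opprD addrA.
have E2 l : chi (l, j, k) != 0 -> d 0 l - d 0 i = d 0 k - d 0 i - d 0 j.
  by move/dd=> <-; rewrite [RHS]addrAC addrK.
have E3 l : chi (i, l, k) != 0 -> d 0 l - d 0 j = d 0 k - d 0 i - d 0 j.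
  by move/dd=> <-; rewrite [d 0 i + _]addrC addrK.
rewrite (sumE _ _ _ _ E1) (sumE _ _ _ _ E2) (sumE _ _ _ _ E3) dx.
by case: ifP => //; rewrite addr0.
Qed.

Definition addiffs d : seq K :=
  undup [seq d 0 p.1 - d 0 p.2 | p <- enum {: 'I_n * 'I_n}].

Lemma mem_addiffs d i j : d 0 i - d 0 j \in addiffs d.
Proof.
by rewrite mem_undup; apply/mapP; exists (i, j); rewrite ?mem_enum.
Qed.

Lemma sum_adcomp d x : x = \sum_(b <- addiffs d) adcomp d b x.
Proof.
apply/matrixP=> i j; rewrite summxE (bigD1_seq (d 0 i - d 0 j)) /=; first last.
- exact: undup_uniq.
- exact: mem_addiffs.
rewrite mxE eqxx big1_seq ?addr0 // => b /andP[nb _].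
by rewrite mxE eq_sym (negPf nb).
Qed.

Lemma adcomp_comm d b x :
  diag_mx d *m adcomp d b x - adcomp d b x *m diag_mx d = b *: adcomp d b x.
Proof.
rewrite mul_diag_mx mul_mx_diag; apply/matrixP=> i j; rewrite !mxE.
by case: eqP => [<-|_]; rewrite ?mulr0 ?mul0r ?subr0 // mulrBl [_ * d 0 j]mulrC.
Qed.

Lemma adcomp_exp d b x k i j :
  (adcomp d b x ^+ k) i j != 0 -> d 0 i - d 0 j = k%:R * b.
Proof.
elim: k i j => [|k IHk] i j.
  rewrite expr0 mxE mul0r; case: (eqVneq i j) => [-> _|_].
    by rewrite subrr.
  by rewrite mulr0n eqxx.
rewrite exprS mxE => nz; apply: contrapT => ne.
case/eqP: nz; apply: big1 => l _; apply: contrapT => /eqP.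
rewrite mulf_eq0 negb_or => /andP[+ /IHk E].
rewrite mxE; case: (d 0 i - d 0 l =P b) => [E1 _|_]; last by rewrite eqxx.
apply: ne; rewrite -natr1 mulrDl mul1r -E -E1.
by rewrite [RHS]addrC addrA subrK.
Qed.

(** A nonzero entry of the [k]-th power makes [k%:R * b] a difference of entries of [d]; these are
    finitely many, while the multiples of [b] are distinct. *)
Lemma adcomp_nilpotent d b x : b != 0 -> exists m, adcomp d b x ^+ m = 0.
Proof.
move=> nz_b; apply: contrapT => /forallNP nz.
pose s := [seq k%:R * b | k <- iota 0 (size (addiffs d)).+1].
have us : uniq s.
  rewrite map_inj_uniq ?iota_uniq // => k l /(mulIf nz_b).
  exact: natr_inj_char0.
suff /(uniq_leq_size us) : {subset s <= addiffs d}.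
  by rewrite size_map size_iota ltnn.
move=> _ /mapP[k _ ->]; have /eqP/matrix0Pn[i [j nzij]] := nz k.
by rewrite -(adcomp_exp nzij) mem_addiffs.
Qed.

Definition regular_der chi psi : set 'M[K]_n :=
  [set D | derivation psi D /\ exists2 g : 'M_n, isom chi psi g
     & exists2 d : 'rV_n, injective (d 0) & invmx g *m D *m g = diag_mx d].

Lemma regular_der_conj chi psi g d : isom chi psi g -> injective (d 0) ->
  derivation chi (diag_mx d) -> regular_der chi psi (g *m diag_mx d *m invmx g).
Proof.
move=> gP inj_d dd; split; first exact: derivation_conj dd.
exists g => //; exists d => //; case: gP => Ug _.
by rewrite !mulmxA mulVmx // mul1mx mulmxKV.
Qed.

Lemma regular_der_dense chi psi g0 d0 : isom chi psi g0 -> injective (d0 0) ->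
  derivation chi (diag_mx d0) ->
  forall f : 'M[K]_n -> K, polyfun f ->
    (forall D, regular_der chi psi D -> f D = 0) ->
    forall D, derivation psi D -> f D = 0.
Proof.
move=> g0P inj_d0 dd0 f Pf.
apply: (polyfun_dense charK0 _ _ _ Pf).
- by exists (g0 *m diag_mx d0 *m invmx g0); apply: regular_der_conj.
- move=> y v [dy _] dv; rewrite addrC -scaleN1r; exact: derivation_linear.
move=> y v [dy [g gP [d inj_d Ed]]] dv; have [Ug _] := gP.
have Ey : y = g *m diag_mx d *m invmx g.
  by rewrite -Ed -!mulmxA mulmxV // mulmx1 mulKVmx.
have dd : derivation chi (diag_mx d).
  rewrite -Ed -[X in _ *m X]invmxK.
  exact: derivation_conj (isomV gP) dy.
pose x := invmx g *m v *m g.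
have dx : derivation chi x.
  by rewrite /x -[X in _ *m X]invmxK; apply: derivation_conj (isomV gP) dv.
(* Transport [v] to [chi], split it into [ad]-eigencomponents, and transport them back. *)
exists [seq g *m adcomp d b x *m invmx g | b <- addiffs d].
  rewrite big_map -mulmx_suml -mulmx_sumr -sum_adcomp /x.
  by rewrite -!mulmxA mulmxV // mulmx1 mulKVmx.
move=> _ /mapP[b _ ->]; clearbody x; have dc := derivation_adcomp b dd dx.
have Eline c : y + c *: (g *m adcomp d b x *m invmx g) =
    g *m (diag_mx d + c *: adcomp d b x) *m invmx g.
  by rewrite mulmxDr mulmxDl -Ey -scalemxAr -scalemxAl.
have dderiv c : derivation chi (diag_mx d + c *: adcomp d b x).
  by rewrite addrC; apply: derivation_linear.
(* For eigenvalue 0 the component need not be nilpotent, but it is diagonal since [d] has distinct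
   entries; moving along it destroys distinctness for finitely many [c] only. *)
have [b0|nz_b] := eqVneq b 0.
  pose e : 'rV[K]_n := \row_i x i i.
  have Ec c : diag_mx d + c *: adcomp d b x = diag_mx (d + c *: e).
    rewrite raddfD /= linearZ /=; congr (_ + _ *: _).
    apply/matrixP=> i j; rewrite b0 !mxE subr_eq0 (inj_eq inj_d).
    by case: eqVneq => [->|_]; rewrite ?mulr1n.
  (* The values of [c] at which two entries collide. When the denominator is zero the quotient is 0,
     which merely excludes one more value. *)
  exists [seq (d 0 p.2 - d 0 p.1) / (e 0 p.1 - e 0 p.2) | p <- enum {: 'I_n * 'I_n}].
  move=> c cP; rewrite Eline Ec; apply: regular_der_conj => //; last by rewrite -Ec.
  move=> i j; rewrite !mxE => E; apply: contrapT => nij.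
  have nz_d : d 0 j - d 0 i != 0.
    by rewrite subr_eq0; apply/eqP=> /inj_d/esym.
  have Ece : c * (x i i - x j j) = d 0 j - d 0 i.
    apply/eqP; rewrite mulrBr subr_eq addrAC eq_sym subr_eq; apply/eqP.
    by rewrite -E addrC.
  case/negP: cP; apply/mapP; exists (i, j); rewrite ?mem_enum //= !mxE.
  rewrite -Ece mulfK //; apply: contraNneq nz_d => e0.
  by rewrite -Ece e0 mulr0.
exists [::] => c _; have [m y0] := adcomp_nilpotent d x nz_b.
(* Scaled so that the displacement [- (b *: z)] of [mxexp_conj] is [c *: adcomp d b x]. *)
pose a := - (c / b); pose z := a *: adcomp d b x.
have dz : derivation chi z.
  by rewrite -[z]addr0; apply: derivation_linear => //; apply: derivation0.
have z0 : z ^+ m = 0.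
  suff -> : z ^+ m = a ^+ m *: adcomp d b x ^+ m by rewrite y0 scaler0.
  elim: (m) => [|k IHk]; first by rewrite scale1r.
  rewrite !exprS IHk -[_ * _]scalemxAl -[X in _ *: X]scalemxAr scalerA.
  by [].
have uP : isom chi chi (mxexp z m).
  split; first exact: mxexp_unit.
  by move=> s t; apply: mxexp_bracket.
have Uu := uP.1.
have Ez : diag_mx d *m z - z *m diag_mx d = b *: z.
  by rewrite -scalemxAr -scalemxAl -scalerBr adcomp_comm !scalerA mulrC.
rewrite Eline; have -> : diag_mx d + c *: adcomp d b x =
    mxexp z m *m diag_mx d *m invmx (mxexp z m).
  rewrite (mxexp_conj charK0 Ez z0) mulmxK //; congr (_ + _).
  by rewrite !scalerA mulrN scaleNr opprK mulrCA divff ?mulr1.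
have -> : g *m (mxexp z m *m diag_mx d *m invmx (mxexp z m)) *m invmx g =
    (g *m mxexp z m) *m diag_mx d *m invmx (g *m mxexp z m).
  by rewrite invmxM // !mulmxA.
by apply: regular_der_conj => //; apply: isomM gP.
Qed.

End RegularDerivations.

(** * Constructibility of regular derivations and monomial isomorphisms *)

Section Conjugacy.
Variables (K : closedFieldType) (n : nat).
Hypothesis charK0 : [pchar K] =i pred0.
Implicit Types (phi psi chi : bilin K n) (d : 'rV[K]_n) (D A B g : 'M[K]_n).

Let N := #|{: 'I_n * 'I_n}|.

Definition env_mx A : seq K := [seq A p.1 p.2 | p <- enum {: 'I_n * 'I_n}].

(** An environment is read as consecutive blocks of [N] scalars, one matrix per block. *)
Definition mx_at (k : nat) (e : seq K) : 'M[K]_n :=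
  \matrix_(i, j) e`_(k * N + enum_rank (i, j)).

Lemma size_env_mx A : size (env_mx A) = N.
Proof. by rewrite size_map -cardE. Qed.

Lemma nth_env_mx A i j : (env_mx A)`_(enum_rank (i, j)) = A i j.
Proof. by rewrite (nth_map (i, j)) ?nth_enum_rank // -cardE. Qed.

Lemma mx_at_cat A e : mx_at 0 (env_mx A ++ e) = A.
Proof.
apply/matrixP=> i j; rewrite mxE nth_cat size_env_mx mul0n add0n ltn_ord.
exact: nth_env_mx.
Qed.

Lemma mx_at_cat_shift A e k : mx_at k.+1 (env_mx A ++ e) = mx_at k e.
Proof.
apply/matrixP=> i j; rewrite !mxE nth_cat size_env_mx mulSn -addnA.
by rewrite ltnNge leq_addr /= addKn.
Qed.

Lemma env_mx_linear k : linear ((fun A => (env_mx A)`_k) : 'M[K]_n -> K^o).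
Proof.
move=> c A B; have [lt_kN|le_Nk] := ltnP k N.
  rewrite -[k]/(nat_of_ord (Ordinal lt_kN)).
  rewrite -(enum_valK (Ordinal lt_kN)); case: (enum_val _) => i' j'.
  by rewrite !nth_env_mx !mxE.
by rewrite !nth_default ?size_env_mx // scaler0 addr0.
Qed.

Lemma termfun_mx_at k i j : termfun (fun e => mx_at k e i j).
Proof.
have [t rt Et] := termfun_var K (k * N + enum_rank (i, j)).
by exists t => // e; rewrite mxE Et.
Qed.

Lemma definable_imp (b : bool) (S : set (seq K)) : definable S ->
  definable (fun e => b -> S e).
Proof.
move=> [f rf Ef]; case: b; last by exists (GRing.Bool true) => // e; split.
by exists f => // e; rewrite Ef; split=> // /(_ isT).
Qed.

Lemma termfun_mx2 k l i j :
  termfun (fun e => (mx_at k e *m mx_at l e) i j).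
Proof.
have -> : (fun e => (mx_at k e *m mx_at l e) i j) =
    fun e => \sum_m mx_at k e i m * mx_at l e m j.
  by apply/funext=> e; rewrite mxE.
by apply: termfun_sum => m; apply: termfun_mul; apply: termfun_mx_at.
Qed.

Lemma termfun_mx3 k l m i j :
  termfun (fun e => (mx_at k e *m mx_at l e *m mx_at m e) i j).
Proof.
have -> : (fun e => (mx_at k e *m mx_at l e *m mx_at m e) i j) =
    fun e => \sum_p (mx_at k e *m mx_at l e) i p * mx_at m e p j.
  by apply/funext=> e; rewrite mxE.
apply: termfun_sum => p.
by apply: termfun_mul; [apply: termfun_mx2 | apply: termfun_mx_at].
Qed.

(** The witnesses hidden in [regular_der]; naming the inverse [B] of [A] turns every condition into
    polynomial equations and inequations. *)
Definition regular_data chi psi D A B :=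
  [/\ A *m B = 1%:M, isom chi psi A, derivation psi D
    & is_diag_mx (B *m D *m A) /\
      forall i j, i != j -> (B *m D *m A) i i <> (B *m D *m A) j j].

Lemma regular_derE chi psi D :
  regular_der chi psi D <-> exists A B, regular_data chi psi D A B.
Proof.
split=> [[dD [g gP [d inj_d Ed]]] | [A [B [AB1 AP dD [diagD injD]]]]].
  have [Ug _] := gP; exists g, (invmx g); split=> //; first exact: mulmxV.
  rewrite Ed diag_mx_is_diag; split=> // i j.
  by rewrite !mxE !eqxx !mulr1n => /eqP nij /inj_d.
have [UA _] := AP; have EB : B = invmx A by rewrite -[B](mulKmx UA) AB1 mulmx1.
split=> //; exists A => //; have /is_diag_mxP Ed := diagD.
exists (\row_i (B *m D *m A) i i) => [i j|].
  rewrite !mxE => E; apply: contrapT => /eqP /injD; apply.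
  by rewrite !mxE.
rewrite -EB; apply/matrixP=> i j; rewrite [RHS]mxE [X in X *+ _]mxE.
by case: eqVneq => [-> //|nij]; rewrite Ed.
Qed.

Lemma definable_regular_data chi psi :
  definable (fun e => regular_data chi psi (mx_at 0 e) (mx_at 1 e) (mx_at 2 e)).
Proof.
pose c1 e := forall i j, (mx_at 1 e *m mx_at 2 e) i j = (i == j)%:R.
pose c2 e := forall i j k, \sum_l mx_at 1 e k l * chi (i, j, l) =
  \sum_p \sum_q mx_at 1 e p i * mx_at 1 e q j * psi (p, q, k).
pose c3 e := forall i j k, \sum_l mx_at 0 e k l * psi (i, j, l) =
  \sum_l mx_at 0 e l i * psi (l, j, k) + \sum_l mx_at 0 e l j * psi (i, l, k).
pose M e := mx_at 2 e *m mx_at 0 e *m mx_at 1 e.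
pose c4 e := forall i j : 'I_n, i != j -> M e i j = 0.
pose c5 e := forall i j : 'I_n, i != j -> M e i i <> M e j j.
have [f rf Ef] : definable (fun e => c1 e /\ c2 e /\ c3 e /\ c4 e /\ c5 e).
  apply: definable_and; last (apply: definable_and;
    last (apply: definable_and; last apply: definable_and)).
  - do 2!apply: definable_forall => ?; apply: definable_eq.
      exact: termfun_mx2.
    exact: termfun_cst.
  - do 3!apply: definable_forall => ?; apply: definable_eq.
      apply: termfun_sum => l; apply: termfun_mul; last exact: termfun_cst.
      exact: termfun_mx_at.
    apply: termfun_sum => p; apply: termfun_sum => q.
    apply: termfun_mul; last exact: termfun_cst.
    by apply: termfun_mul; apply: termfun_mx_at.
  - do 3!apply: definable_forall => ?; apply: definable_eq.
      apply: termfun_sum => l; apply: termfun_mul; last exact: termfun_cst.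
      exact: termfun_mx_at.
    by apply: termfun_add; apply: termfun_sum => l; apply: termfun_mul;
      [exact: termfun_mx_at | exact: termfun_cst
      | exact: termfun_mx_at | exact: termfun_cst].
  - do 2!apply: definable_forall => ?; apply: definable_imp.
    by apply: definable_eq; [exact: termfun_mx3 | exact: termfun_cst].
  - do 2!apply: definable_forall => ?; apply: definable_imp; apply: definable_not.
    by apply: definable_eq; exact: termfun_mx3.
exists f => // e; rewrite Ef; split=> [[E1 [E2 [E3 [E4 E5]]]]|].
  have AB1 : mx_at 1 e *m mx_at 2 e = 1%:M.
    by apply/matrixP=> i j; rewrite E1 mxE.
  split=> //; last 1 first.
  - by split=> //; apply/is_diag_mxP=> i j; apply: E4.
  - by apply/isomE; split=> //; case: (mulmx1_unit AB1).
  exact/derivationE.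
case=> AB1 /isomE[_ AP] /derivationE dD [/is_diag_mxP diagD injD].
by split=> [i j|]; [rewrite AB1 mxE | do 3!split=> //; apply: diagD].
Qed.

Lemma affine_derivation psi : affine [set D | derivation psi D].
Proof.
move=> x y c dx dy; rewrite addrC; apply: derivation_linear => //.
by rewrite addrC -scaleN1r; apply: derivation_linear.
Qed.

Lemma generic_regular_der chi psi g d : isom chi psi g -> injective (d 0) ->
  derivation chi (diag_mx d) ->
  generic [set D | derivation psi D] (regular_der chi psi).
Proof.
move=> gP inj_d dd.
(* Block 0, holding [D], stays free; the [2 * N] variables from index [N] on, holding [A] and [B],
   are quantified. *)
have [f wf_f Ef] := definable_qf (iota N (N + N)) (definable_regular_data chi psi).
apply: (generic_dense charK0 env_mx_linear _ _ wf_f) => [|||q Pq q0|].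
- exact: affine_derivation.
- by exists 0; apply: derivation0.
- move=> D; rewrite Ef regular_derE; split=> [[e eq_e De] | [A [B DAB]]].
    exists (mx_at 1 e), (mx_at 2 e); suff -> : D = mx_at 0 e by [].
    apply/matrixP=> i j; rewrite -nth_env_mx mxE mul0n add0n; apply: eq_e.
    by rewrite !inE mem_iota negb_and -ltnNge ltn_ord.
  exists (env_mx D ++ env_mx A ++ env_mx B); last first.
    have := mx_at_cat B [::]; rewrite cats0 => EB.
    by rewrite !mx_at_cat_shift !mx_at_cat EB.
  move=> k; rewrite !inE mem_iota negb_and -ltnNge -leqNgt => /orP[lt_kN|le_Nk].
    by rewrite nth_cat size_env_mx lt_kN.
  (* Beyond the three blocks both environments take the default value 0. *)
  by rewrite !nth_default // ?size_cat !size_env_mx // (leq_trans _ le_Nk) ?leq_addr.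
- by apply: (regular_der_dense charK0 gP inj_d dd Pq) => D; apply: q0.
by move=> D [].
Qed.

(* Regular derivations of psi are generic both among the conjugates of diagonal
   derivations of phi and among those of psi, hence some is of both kinds. *)
Lemma isom_monomial phi psi d d' : isomorphic phi psi ->
  injective (d 0) -> derivation phi (diag_mx d) ->
  injective (d' 0) -> derivation psi (diag_mx d') ->
  exists g (e e' : 'rV[K]_n), [/\ isom phi psi g, injective (e 0),
    injective (e' 0) & g *m diag_mx e = diag_mx e' *m g].
Proof.
move=> /isomorphicP[g gP] inj_d dd inj_d' dd'.
have G1 := generic_regular_der gP inj_d dd.
have G2 := generic_regular_der (isom1 psi) inj_d' dd'.
have [D dD [[_ [h hP [e inj_e Ee]]] [_ [h' h'P [e' inj_e' Ee']]]]] :=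
  generic_ex (generic_and charK0 (@affine_derivation psi) G1 G2).
have [[Uh _] [Uh' _]] := (hP, h'P).
(* [D] is both [h *m diag_mx e *m invmx h] and [h' *m diag_mx e' *m invmx h']. *)
exists (invmx h' *m h), e, e'; split=> //; first exact: isomM hP (isomV h'P).
by rewrite -Ee -Ee' !mulmxA (mulmxK Uh) (mulmxK Uh').
Qed.

End Conjugacy.

(** * Admissible sets as bases of weight forms on the support of a law *)

Section Admissible.
Variables (K : closedFieldType) (T : vectType K) (alpha : nat -> 'Hom(T, K^o)).
Variable n : nat.
Implicit Types (phi psi : bilin K n) (l : 'rV[K]_n) (L : 'M[K]_n).
Implicit Types (a b : midx n) (A B : {set midx n}) (t : T).

Definition wrow t : 'rV[K]_n := \row_i alpha i t.

(** The factor by which the coboundary of a diagonal [l] multiplies the structure constant at [a];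
    the common kernel over the support of a law is its space of diagonal derivations. *)
Definition wform a l : K := l 0 a.1.1 + l 0 a.1.2 - l 0 a.2.

Lemma wform_linear a : linear (wform a : 'rV[K]_n -> K^o).
Proof.
move=> c l m; rewrite /wform !mxE -[c *: (_ : K^o)]/(c * _).
by rewrite mulrBr mulrDr opprD [LHS](AC (2*2*2) ((1*3*5)*(2*4*6))).
Qed.

Lemma lfun_basisP (f g : 'Hom(T, K^o)) :
  (forall t, t \in vbasis {:T} -> f t = g t) -> f = g.
Proof.
move=> Efg; apply/lfunP=> t; rewrite (coord_vbasis (memvf t)) !linear_sum.
apply: eq_bigr => i _; rewrite !linearZ /= Efg //.
by apply: mem_nth; rewrite size_tuple.
Qed.

Lemma mem_bigcap_lker (V W : vectType K) (f : T -> 'Hom(V, W)) (s : seq T) v :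
  reflect (forall t, t \in s -> f t v = 0)
    (v \in (\bigcap_(t <- s) lker (f t))%VS).
Proof.
elim: s => [|t s IHs]; first by rewrite big_nil memvf; left.
rewrite big_cons; apply: (iffP memv_capP); rewrite memv_ker.
  by move=> [/eqP ft /IHs fs] u; rewrite inE => /predU1P[->|/fs].
move=> fs; split; first by rewrite fs ?mem_head.
by apply/IHs => u su; apply: fs; rewrite inE su orbT.
Qed.

Lemma lawsT_weight phi : lawsT alpha phi -> forall i j k,
  phi (i, j, k) != 0 -> alpha i + alpha j = alpha k.
Proof.
move=> [_ dT] i j k nz; apply/lfunP=> t; rewrite add_lfunE.
by have /derivation_diag/(_ _ _ _ nz) := dT t; rewrite !mxE.
Qed.

Lemma weight_derivation phi :
  (forall i j k, phi (i, j, k) != 0 -> alpha i + alpha j = alpha k) ->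
  forall t, derivation phi (weight_mx alpha n t).
Proof.
move=> wP t; apply/derivation_diag=> i j k /wP E.
by rewrite !mxE -E add_lfunE.
Qed.

Lemma coboundaryE phi L i j k : coboundary phi L (i, j, k) =
  \sum_l L l j * phi (i, l, k) + \sum_l L l i * phi (l, j, k)
  - \sum_l L k l * phi (i, j, l).
Proof.
rewrite ffunE /= [LHS]mxE [X in X + _]mxE [X in _ + X]mxE.
rewrite bracket_mulmx_deltal bracket_mulmx_deltar.
by rewrite mulmx_bracket_delta.
Qed.

Lemma sum_diag_mxl l (F : 'I_n -> K) j :
  \sum_m diag_mx l m j * F m = l 0 j * F j.
Proof.
rewrite (bigD1 j) //= mxE eqxx mulr1n big1 ?addr0 // => m /negPf nmj.
by rewrite mxE nmj mul0r.
Qed.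

Lemma sum_diag_mxr l (F : 'I_n -> K) k :
  \sum_m diag_mx l k m * F m = l 0 k * F k.
Proof.
rewrite (bigD1 k) //= mxE eqxx mulr1n big1 ?addr0 // => m /negPf nmk.
by rewrite mxE eq_sym nmk mul0r.
Qed.

Lemma coboundary_diag phi l a : coboundary phi (diag_mx l) a = wform a l * phi a.
Proof.
case: a => [[i j] k]; rewrite coboundaryE /wform /= !sum_diag_mxl sum_diag_mxr.
by rewrite mulrBl mulrDl [X in X - _ = _]addrC.
Qed.

Lemma gl_act2_diag l (f : bilin K n) a :
  gl_act2 (diag_mx l) f a = - wform a l * f a.
Proof.
case: a => [[i j] k]; rewrite ffunE /= [LHS]mxE [X in X + _]mxE.
rewrite [X in _ + X + _]mxE [X in _ + X]mxE.
rewrite bracket_mulmx_deltal bracket_mulmx_deltar mulmx_bracket_delta.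
rewrite !sum_diag_mxl sum_diag_mxr /wform /= mulNr mulrBl mulrDl opprB opprD.
by rewrite addrA.
Qed.

Lemma invT2P (f : bilin K n) : reflect
  (forall i j k, f (i, j, k) != 0 -> alpha i + alpha j = alpha k)
  (f \in invT2 alpha n).
Proof.
apply: (iffP (mem_bigcap_lker _ _ _)) => [inv i j k nz|wP t _].
  apply: lfun_basisP => t /inv; rewrite lfunE /= => /ffunP/(_ (i, j, k)).
  rewrite gl_act2_diag [RHS]ffunE /wform /= !mxE => /eqP.
  rewrite mulf_eq0 (negPf nz) orbF oppr_eq0 subr_eq0 => /eqP E.
  by rewrite add_lfunE.
rewrite lfunE; apply/ffunP=> -[[i j] k] /=; rewrite gl_act2_diag [RHS]ffunE.
have [->|/wP E] := eqVneq (f (i, j, k)) 0; first by rewrite mulr0.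
by rewrite /wform /= !mxE -E add_lfunE subrr oppr0 mul0r.
Qed.

Hypothesis alpha_inj : injective alpha.

Lemma C1TP L : reflect (exists l, L = diag_mx l) (L \in C1T alpha n).
Proof.
have E t i j : gl_act1 (weight_mx alpha n t) L i j =
    (alpha i t - alpha j t) * L i j.
  rewrite /gl_act1 [LHS]mxE [X in _ + X]mxE /weight_mx mul_diag_mx mul_mx_diag !mxE.
  by rewrite mulrBl [L i j * _]mulrC.
apply: (iffP (mem_bigcap_lker _ _ _)) => [inv|[l ->] t _].
  exists (\row_i L i i); apply/matrixP=> i j; rewrite !mxE.
  have [->|nij] := eqVneq i j; first by rewrite mulr1n.
  rewrite mulr0n; apply: contrapT => /eqP nzL; case/eqP: nij.
  apply/val_inj/alpha_inj/lfun_basisP => t /inv.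
  rewrite lfunE /= => /matrixP/(_ i j); rewrite E [RHS]mxE => /eqP.
  by rewrite mulf_eq0 (negPf nzL) orbF subr_eq0 => /eqP.
rewrite lfunE /= /gl_act1 /weight_mx !mul_diag_mx.
apply/matrixP=> i j; rewrite !mxE.
by case: (eqVneq i j) => [->|_]; rewrite ?mulr0n ?mulr0 ?mul0r ?subrr // mulrC subrr.
Qed.

(** An invariant coboundary is already the coboundary of the diagonal part of [L], since the
    differential of an invariant law preserves weights. *)
Lemma B2T_img phi : lawsT alpha phi ->
  B2T alpha phi = (linfun (coboundary phi) @: C1T alpha n)%VS.
Proof.
move=> phiL; apply/vspaceP=> f; apply/memv_capP/memv_imgP.
  move=> [/memv_imgP[L _ ->]]; rewrite lfunE /= => /invT2P wP.
  exists (diag_mx (\row_i L i i)); first by apply/C1TP; eexists.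
  rewrite lfunE /=; apply/ffunP=> -[[i j] k]; rewrite coboundary_diag /wform !mxE /=.
  have wL := lawsT_weight phiL.
  have [E|nE] := eqVneq (alpha i + alpha j) (alpha k); last first.
    have -> : phi (i, j, k) = 0.
      by apply: contrapT => /eqP/wL/eqP; rewrite (negPf nE).
    rewrite mulr0; apply: contrapT => /eqP/wP/eqP; by rewrite (negPf nE).
  (* Since the weights are distinct, two indices of a nonzero structure constant determine the
     third, so each sum has one term. *)
  have one (F G : 'I_n -> K) m : (forall q, G q != 0 -> q = m) ->
      \sum_q F q * G q = F m * G m.
    move=> Gm; rewrite (bigD1 m) //= big1 ?addr0 // => q nqm.
    have [->|/Gm Eq] := eqVneq (G q) 0; first by rewrite mulr0.
    by rewrite Eq eqxx in nqm.
  rewrite coboundaryE (one _ (fun q => phi (i, q, k)) j) => [|q /wL]; last first.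
    by rewrite -E => /addrI/alpha_inj/val_inj.
  rewrite (one _ (fun q => phi (q, j, k)) i) => [|q /wL]; last first.
    by rewrite -E => /addIr/alpha_inj/val_inj.
  rewrite (one _ (fun q => phi (i, j, q)) k) => [|q /wL]; last first.
    by rewrite E => /alpha_inj/val_inj.
  by rewrite mulrBl mulrDl [X in X - _ = _]addrC.
move=> [_ /C1TP[l ->] ->]; split; first by rewrite memv_img ?memvf.
rewrite lfunE; apply/invT2P=> i j k; rewrite coboundary_diag mulf_eq0 negb_or.
by move=> /andP[_ /(lawsT_weight phiL)].
Qed.

Definition killed A l := forall a, a \in A -> wform a l = 0.

(** The rank is maximal exactly when restriction to [A] is injective on coboundaries. *)
Lemma rank_forms_max phi A : lawsT alpha phi ->
  reflect
    (forall l, (forall a, a \in A -> phi a != 0 -> wform a l = 0) ->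
       forall a, phi a != 0 -> wform a l = 0)
    (rank_forms alpha phi A == \dim (B2T alpha phi)).
Proof.
move=> phiL; rewrite /rank_forms limg_comp B2T_img //.
set U := (linfun (coboundary phi) @: _)%VS.
rewrite -[X in _ == X](limg_ker_dim (linfun (restr A)) U).
rewrite -{1}[\dim (linfun (restr A) @: U)]add0n eqn_add2r eq_sym dimv_eq0 -subv0.
apply: (iffP subvP) => [K0 l lA a nz | Kl f].
  pose f := coboundary phi (diag_mx l).
  have : f \in 0%VS.
    apply: K0; apply/memv_capP; split.
      rewrite /f -lfunE memv_img //; apply/C1TP; by exists l.
    rewrite memv_ker lfunE; apply/eqP/ffunP=> b; rewrite [LHS]ffunE [RHS]ffunE.
    case: ifP => // bA; rewrite coboundary_diag.
    have [->|/(lA b bA) ->] := eqVneq (phi b) 0; first by rewrite mulr0.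
    by rewrite mul0r.
  rewrite memv0 => /eqP/ffunP/(_ a); rewrite /f coboundary_diag [RHS]ffunE.
  by move/eqP; rewrite mulf_eq0 (negPf nz) orbF => /eqP.
move=> /memv_capP[/memv_imgP[_ /C1TP[l ->] ->]]; rewrite lfunE memv_ker lfunE /=.
move=> /eqP/ffunP r0; rewrite memv0; apply/eqP/ffunP=> a.
rewrite coboundary_diag [RHS]ffunE.
have [->|nz] := eqVneq (phi a) 0; first by rewrite mulr0.
rewrite (Kl l) ?mul0r // => b bA nzb; have := r0 b.
rewrite [LHS]ffunE bA coboundary_diag [RHS]ffunE => /eqP.
by rewrite mulf_eq0 (negPf nzb) orbF => /eqP.
Qed.

(** Linear independence of the forms attached to [A], phrased by vectors isolating each of them. *)
Definition windep A := forall a, a \in A ->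
  exists2 l, wform a l != 0 & killed (A :\ a) l.

(** By minimality, dropping [a] loses rank, and the vector witnessing the loss isolates the form at
    [a]. It also forces [phi a != 0], as a zero coefficient contributes no rank. *)
Lemma admissibleP phi A : lawsT alpha phi ->
  admissible alpha phi A <->
  [/\ A \subset weight_idx alpha n, forall a, a \in A -> phi a != 0, windep A
    & forall l, killed A l -> forall a, phi a != 0 -> wform a l = 0].
Proof.
move=> phiL; split=> [/minsetP[/andP[sAw /(rank_forms_max _ phiL) gA] minA]|].
  have wit a : a \in A -> exists l, [/\ phi a != 0, wform a l != 0
      & forall b, b \in A :\ a -> phi b != 0 -> wform b l = 0].
    move=> aA; have : ~ (rank_forms alpha phi (A :\ a) == \dim (B2T alpha phi)).
      move=> gAa; have := minA (A :\ a); rewrite gAa andbT.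
      move/(_ (fintype.subset_trans (subD1set _ _) sAw) (subD1set _ _)) => E.
      by move: aA; rewrite -E !inE eqxx.
    move/(contra_not (introT (rank_forms_max (A :\ a) phiL))).
    move=> /existsNP[l /not_implyP[lA nl]].
    exists l; have [nza nzl] : phi a != 0 /\ wform a l != 0; last by split.
    apply/andP; rewrite -negb_or; apply/negP=> /orP za; apply: nl.
    apply: gA => b bA nzb; have [Eb|nb] := eqVneq b a; last first.
      by apply: lA => //; rewrite !inE nb.
    by case: za => /eqP za //; rewrite Eb // za eqxx in nzb *.
  have nzA a : a \in A -> phi a != 0 by case/wit=> l [].
  split=> // [a /wit[l [_ nzl lA]]|l lA].
    exists l => // b bAa; apply: lA => //; apply: nzA.
    by move: bAa; rewrite !inE => /andP[].
  by apply: gA => a aA _; apply: lA.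
move=> [sAw nzA indA gA]; apply/minsetP.
split=> [|B /andP[_ /(rank_forms_max _ phiL) gB] sBA].
  rewrite sAw; apply/(rank_forms_max _ phiL) => l lA; apply: gA => a aA.
  by apply: lA => //; apply: nzA.
apply/eqP; rewrite finset.eqEsubset sBA; apply/fintype.subsetP=> a aA.
apply: contraT => naB; have [l nzl lA] := indA a aA; case/eqP: nzl.
apply: gB (nzA a aA) => b bB _; apply: lA; rewrite !inE (fintype.subsetP sBA) // andbT.
by apply: contraNneq naB => <-.
Qed.

Lemma law_antisym phi i j k : lie_law phi -> phi (j, i, k) = - phi (i, j, k).
Proof.
move=> [alt _]; apply/eqP; rewrite -addr_eq0 -!bracket_delta; apply/eqP.
have addl x y z : bracket phi (x + y) z = bracket phi x z + bracket phi y z.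
  by have := bracket_linearl phi z 1 x y; rewrite !scale1r.
have addr x y z : bracket phi x (y + z) = bracket phi x y + bracket phi x z.
  by have := bracket_linearr phi x 1 y z; rewrite !scale1r.
have := alt (delta_mx i 0 + delta_mx j 0).
rewrite addl !addr !alt add0r addr0 => /matrixP/(_ k 0).
by rewrite !mxE addrC.
Qed.

Lemma law_diag phi i k : lie_law phi -> phi (i, i, k) = 0.
Proof. by move=> [alt _]; rewrite -bracket_delta alt mxE. Qed.

(** Basis completion: a maximal independent set of forms on the support spans all of them. *)
Lemma admissible_extend phi A : lawsT alpha phi ->
  A \subset weight_idx alpha n -> (forall a, a \in A -> phi a != 0) ->
  windep A ->
  exists2 B : {set midx n}, A \subset B & admissible alpha phi B.
Proof.
move=> phiL sAw nzA indA.
pose P (B : {set midx n}) := [&& B \subset weight_idx alpha n,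
  [forall a in B, phi a != 0] & `[< windep B >]].
have PA : P A.
  by apply/and3P; split=> //; [apply/forall_inP | apply/asboolP].
have [B /maxsetP[/and3P[sBw /forall_inP nzB /asboolP indB] maxB] sAB] :=
  maxset_exists PA.
exists B => //; apply/(admissibleP B phiL); split=> // l lB.
(* [weight_idx] keeps only [i < j]; antisymmetry and alternation handle the other indices. *)
suff key a : a \in weight_idx alpha n -> phi a != 0 -> wform a l = 0.
  move=> [[i j] k] nz; have wE := lawsT_weight phiL nz.
  have [ltij|ltji|/val_inj Eij] := ltngtP i j.
  - by apply: key nz; rewrite inE /= ltij wE eqxx.
  - have := key (j, i, k); rewrite /wform /= [l 0 j + _]addrC; apply.
      by rewrite inE /= ltji addrC wE eqxx.
    by rewrite (law_antisym i j) ?oppr_eq0 //; case: phiL.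
  by move: nz; rewrite Eij law_diag ?eqxx //; case: phiL.
move=> aw nz; apply: contrapT => /eqP nzl.
have naB : a \notin B by apply: contraNN nzl => aB; rewrite lB.
have Ba : P (a |: B)%SET.
  apply/and3P; split.
  - by apply/fintype.subsetP=> b /setU1P[-> //|]; apply: (fintype.subsetP sBw).
  - by apply/forall_inP=> b /setU1P[-> //|/nzB].
  apply/asboolP=> b /setU1P[->|bB].
    exists l => // c; rewrite !inE => /andP[/negPf->] /=; exact: lB.
  have [m nzm mB] := indB b bB.
  (* Subtract the multiple of [l] that kills the form at [a]; values on [B] do not change, since [l]
     is killed there. *)
  exists (- (wform a m / wform a l) *: l + m).
    by rewrite wform_linear (lB _ bB) scaler0 add0r.
  move=> c; rewrite !inE => /andP[ncb /orP[/eqP->|cB]].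
    rewrite wform_linear -[_ *: (_ : K^o)]/(_ * _) mulNr divfK //.
    by rewrite addNr.
  by rewrite wform_linear (lB _ cB) scaler0 add0r mB // !inE ncb.
have := maxB _ Ba (finset.subsetUr _ _) => E.
by case/negP: naB; rewrite -E setU11.
Qed.

End Admissible.

(** * Solving monomial equations with independent exponents *)

Section WeightSystem.
Variables (K : closedFieldType) (n : nat) (A : {set midx n}).
Hypothesis indepA : windep K A.
Implicit Types (l : 'rV[K]_n) (x : K).

(** Coefficients of [wform a], kept in [int] because they also serve as exponents. *)
Definition wcoef (a : midx n) (i : 'I_n) : int :=
  (i == a.1.1)%:Z + (i == a.1.2)%:Z - (i == a.2)%:Z.

Definition wmatrix : 'M[int]_(n, #|A|) :=
  \matrix_(i, c) wcoef (enum_val c) i.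

Definition wmatrixK : 'M[K]_(n, #|A|) := map_mx intr wmatrix.

Lemma mul_wmatrixK l c : (l *m wmatrixK) 0 c = wform (enum_val c) l.
Proof.
have sum1 (j : 'I_n) : \sum_i l 0 i * (i == j)%:Z%:~R = l 0 j.
  rewrite (bigD1 j) //= eqxx mulr1 big1 ?addr0 // => i /negPf->.
  by rewrite mulr0.
rewrite mxE /wform -!sum1 -big_split -sumrB /=; apply: eq_bigr => i _.
by rewrite !mxE /wcoef rmorphB rmorphD /= mulrBr mulrDr.
Qed.

(** The isolating vectors form a matrix whose product with [wmatrixK] is diagonal and invertible. *)
Lemma row_full_wmatrixK : row_full wmatrixK.
Proof.
have /choice[w wP] (c : 'I_#|A|) : exists l : 'rV[K]_n,
    wform (enum_val c) l != 0 /\ killed (A :\ enum_val c) l.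
  by have [l] := indepA (enum_valP c); exists l.
pose W : 'M[K]_(#|A|, n) := \matrix_c w c.
have UW : W *m wmatrixK \in unitmx.
  have -> : W *m wmatrixK = diag_mx (\row_c wform (enum_val c) (w c)).
    apply/matrixP=> c c'.
    have -> : (W *m wmatrixK) c c' =
        (row c (W *m wmatrixK)) 0 c' by rewrite [RHS]mxE.
    rewrite row_mul rowK mul_wmatrixK !mxE.
    have [->|ne] := eqVneq c c'; first by rewrite mulr1n.
    rewrite mulr0n; apply: (wP c).2; rewrite !inE enum_valP andbT.
    by rewrite (inj_eq enum_val_inj) eq_sym.
  rewrite unitmxE det_diag unitfE; apply/prodf_neq0 => c _.
  by rewrite mxE; case: (wP c).
rewrite /row_full eqn_leq rank_leq_col /=.
by have := mxrankM_maxr W wmatrixK; rewrite (mxrank_unit UW).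
Qed.

Lemma closed_field_root x k : (0 < k)%N -> exists y, y ^+ k = x.
Proof.
move=> k_gt0; have /closed_rootP[y] : size ('X^k - x%:P) != 1%N.
  by rewrite size_XnsubC // eqSS -lt0n.
by rewrite rootE !hornerE subr_eq0 => /eqP; exists y.
Qed.

Lemma closed_field_rootz x (z : int) : z != 0 -> x != 0 ->
  exists2 y, y != 0 & y ^ z = x.
Proof.
case: z => k nz_k nz_x.
  have [|y Ey] := @closed_field_root x k; first by rewrite lt0n.
  exists y => //; apply: contraNneq nz_x => y0; move: nz_k.
  by rewrite -Ey y0 expr0n -[Posz k == 0]/(k == 0%N) => /negPf->.
have [//|y Ey] := @closed_field_root x^-1 k.+1.
exists y; last by rewrite NegzE -exprnN Ey invrK.
apply: contraNneq nz_x => y0; have : x^-1 == 0 by rewrite -Ey y0 expr0n.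
by rewrite invr_eq0.
Qed.

(* The exponent matrix has a square block of nonzero determinant; its adjugate
   inverts it up to that determinant, which is absorbed by extracting roots. *)
Lemma solve_weights (c : midx n -> K) : (forall a, a \in A -> c a != 0) ->
  exists s : 'I_n -> K, (forall i, s i != 0) /\
    forall a, a \in A -> s a.2 / (s a.1.1 * s a.1.2) = c a.
Proof.
move=> nz_c; have fullM := row_full_wmatrixK.
pose f := fullrankfun fullM; pose N := rowsub f wmatrix.
pose D := \det N.
have nz_D : D != 0.
  have := fullrowsub_unit fullM; rewrite -/f.
  have -> : rowsub f wmatrixK = map_mx intr N by apply/matrixP=> i j; rewrite !mxE.
  rewrite unitmxE det_map_mx unitfE -/D; apply: contraNneq => ->.
  by rewrite rmorph0.
(* The inverse appears because the monomial with exponents [wcoef] is the inverse of the required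
   quotient. *)
have /choice[b bP] (r : 'I_#|A|) :
    exists y : K, y != 0 /\ y ^ D = (c (enum_val r))^-1.
  have [||y y0 Ey] := @closed_field_rootz (c (enum_val r))^-1 D => //.
    by rewrite invr_eq0 nz_c ?enum_valP.
  by exists y.
pose u (p : 'I_#|A|) := \prod_r b r ^ (\adj N r p).
(* Coordinates outside the chosen block receive the empty product 1. *)
pose s i := \prod_(p | f p == i) u p.
have nz_u p : u p != 0.
  by apply/prodf_neq0 => r _; apply: expfz_neq0; case: (bP r).
have nz_s i : s i != 0 by apply/prodf_neq0.
have powprod (I : finType) (P : pred I) (F : I -> K) (z : int) :
    (\prod_(i | P i) F i) ^ z = \prod_(i | P i) F i ^ z.
  by apply: (big_morph (fun x => x ^ z)) => [x y|]; rewrite ?expfzMl ?exp1rz.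
have powsum (I : finType) (F : I -> int) x : x != 0 ->
    x ^ (\sum_i F i) = \prod_i x ^ F i.
  move=> nz_x; apply: (big_morph (fun z => x ^ z)) => [y z|]; rewrite ?expr0z //.
  exact: expfzDr.
exists s; split=> // a aA; pose r := enum_rank_in aA a.
have Er : enum_val r = a by apply: enum_rankK_in.
have prod_s : \prod_i s i ^ wcoef a i = (c a)^-1.
  have -> : \prod_i s i ^ wcoef a i = \prod_p u p ^ N p r.
    rewrite [RHS](partition_big f predT) //=; apply: eq_bigr => i _.
    rewrite powprod; apply: eq_bigr => p /eqP <-.
    by rewrite !mxE Er.
  rewrite /u; under eq_bigr do rewrite powprod.
  (* The exponent of [b q] is the entry [(q, r)] of [\adj N *m N]: it is [D] if [q = r] and 0
     otherwise. *)
  rewrite exchange_big (bigD1 r) //= [X in _ * X]big1 ?mulr1 => [|q /negPf nqr].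
    rewrite /=; under eq_bigr do rewrite exprz_exp.
    have [nz_b Eb] := bP r; rewrite -[in RHS]Er -Eb -powsum //; congr (_ ^ _).
    have := congr1 (fun X : 'M[int]_#|A| => X r r) (mul_adj_mx N).
    by rewrite mxE [RHS]mxE eqxx mulr1n.
  rewrite /=; under eq_bigr do rewrite exprz_exp.
  have [nz_b _] := bP q; rewrite -powsum //.
  have := congr1 (fun X : 'M[int]_#|A| => X q r) (mul_adj_mx N).
  by rewrite mxE [RHS]mxE nqr mulr0n => ->; rewrite expr0z.
have prod1 (j : 'I_n) : \prod_i s i ^ (i == j)%:Z = s j.
  rewrite (bigD1 j) //= eqxx expr1z big1 ?mulr1 // => i /negPf->.
  by rewrite expr0z.
apply: invr_inj; rewrite -prod_s invf_div.
under eq_bigr do rewrite /wcoef !expfzDr // -exprz_inv.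
rewrite !big_split /= !prod1; congr (_ * _ * _).
rewrite -[in LHS](prod1 a.2) -prodfV; apply: eq_bigr => i _.
by rewrite exprz_inv invr_expz.
Qed.

End WeightSystem.

(** * The torus as the common kernel of the weight forms *)

Section TorusKernel.
Variables (K : closedFieldType) (T : vectType K) (alpha : nat -> 'Hom(T, K^o)).
Variables (n0 n : nat).
Hypothesis le_n0n : (n0 <= n)%N.
Hypothesis alpha_span : <<[seq alpha i | i <- iota 0 n0]>>%VS = fullv.
Hypothesis charK0 : [pchar K] =i pred0.

Lemma weights_separate (t : T) : (forall i : 'I_n, alpha i t = 0) -> t = 0.
Proof.
move=> t0; have ft0 (f : 'Hom(T, K^o)) : f t = 0.
  have : f \in <<in_tuple [seq alpha i | i <- iota 0 n0]>>%VS.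
    by rewrite alpha_span memvf.
  move/coord_span->; rewrite sum_lfunE big1 // => i _.
  have lt_i : (i < n0)%N.
    by have := ltn_ord i; rewrite [X in (_ < X)%N]size_map size_iota.
  rewrite scale_lfunE (nth_map 0%N) ?size_iota // nth_iota // add0n.
  by rewrite (t0 (Ordinal (leq_trans lt_i le_n0n))) scaler0.
rewrite (coord_vbasis (memvf t)) big1 // => i _.
have := ft0 (linfun (coord (vbasis {:T}) i : T -> K^o)).
by rewrite lfunE /= => ->; rewrite scale0r.
Qed.

(** The weight relations put the image of [T] inside the common kernel of the forms; both have
    dimension [\dim {:T}], so they coincide. *)
Lemma killed_torus (A : {set midx n}) (l : 'rV[K]_n) :
  windep K A -> A \subset weight_idx alpha n ->
  #|A| = (n - \dim {:T})%N -> killed A l -> exists t, l = wrow alpha n t.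
Proof.
move=> indA sAw cardA lA; set m := \dim {:T} in cardA.
pose V : 'M[K]_(m, n) := \matrix_b wrow alpha n (vbasis {:T})`_b.
have mulV (v : 'rV_m) : v *m V = wrow alpha n (\sum_b v 0 b *: (vbasis {:T})`_b).
  apply/matrixP=> i j; rewrite ord1 !mxE linear_sum; apply: eq_bigr => b _.
  by rewrite linearZ !mxE.
have freeV : row_free V.
  apply: inj_row_free => v; rewrite mulV => /matrixP v0.
  have /weights_separate/freeP : forall i : 'I_n,
      alpha i (\sum_b v 0 b *: (vbasis {:T})`_b) = 0.
    by move=> i; have := v0 0 i; rewrite !mxE.
  move/(_ (basis_free (vbasisP _))) => vb0.
  by apply/matrixP=> i j; rewrite ord1 vb0 mxE.
have VM : (V <= kermx (wmatrixK K A))%MS.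
  apply/sub_kermxP/row_matrixP=> b; rewrite row0 row_mul rowK.
  apply/matrixP=> i c; rewrite ord1 mul_wmatrixK /wform !mxE.
  have /(fintype.subsetP sAw) := enum_valP c.
  by rewrite inE => /andP[_ /eqP <-]; rewrite add_lfunE subrr.
(* Freeness of [V] gives [m <= n], so the truncated subtraction in [cardA] is a true one. *)
have rankV : \rank V = \rank (kermx (wmatrixK K A)).
  rewrite mxrank_ker (eqP (row_full_wmatrixK indA)) (eqP freeV) cardA subKn //.
  by rewrite -(eqP freeV) rank_leq_col.
have [_] := mxrank_leqif_sup VM; rewrite rankV eqxx => /esym kV.
have lV := fun X => submx_trans X kV.
have /lV/submxP[v ->] : (l <= kermx (wmatrixK K A))%MS.
  apply/sub_kermxP/matrixP=> i c; rewrite ord1 mul_wmatrixK mxE.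
  by apply: lA; apply: enum_valP.
by rewrite mulV; eexists.
Qed.

(** Differences of distinct weights are finitely many nonzero linear forms, so some vector
    annihilates none of them. *)
Lemma separating_vector : injective alpha ->
  exists t : T, injective (wrow alpha n t 0).
Proof.
move=> alpha_inj.
pose F (p : 'I_n * 'I_n) (t : T) : K := alpha p.1 t - alpha p.2 t.
pose s := [seq p <- enum {: 'I_n * 'I_n} | p.1 != p.2].
have [|p|t tP] := @polyfun_neq0_common K T charK0 _ s F.
- move=> p; apply: polyfun_lin => c u v.
  by rewrite /F [alpha p.1 _]linearP [alpha p.2 _]linearP opprD addrACA scalerBr.
- rewrite mem_filter => /andP[np _]; apply: contrapT => /forallNP F0.
  case/eqP: np; apply/val_inj/alpha_inj/lfunP => t; apply/eqP.
  by rewrite -subr_eq0; apply/negPn/negP/F0.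
exists t => i j; rewrite !mxE => E; apply/eqP; apply: contraT => nij.
have : (i, j) \in s by rewrite mem_filter nij mem_enum.
by move/tP; rewrite /F /= E subrr eqxx.
Qed.

End TorusKernel.

(** * Identity components equal to the diagonal group *)

Section IdentityComponent.
Variables (K : closedFieldType) (n : nat).
Hypothesis charK0 : [pchar K] =i pred0.
Implicit Types (g h : 'M[K]_n) (d : 'rV[K]_n).

Definition diag_units : set 'M[K]_n :=
  [set g | exists2 d : 'rV_n, (forall i, d 0 i != 0) & g = diag_mx d].

Lemma diag_mx_intro g : (forall i j, i != j -> g i j = 0) ->
  g = diag_mx (\row_i g i i).
Proof.
move=> g0; apply/matrixP=> i j; rewrite !mxE.
by have [->|/g0->] := eqVneq i j; rewrite ?mulr1n.
Qed.

Lemma diag_unitsP g : diag_units g <->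
  g \in unitmx /\ forall i j, i != j -> g i j = 0.
Proof.
split=> [[d d0 ->]|[Ug g0]].
  rewrite unitmxE det_diag unitfE; split; first by apply/prodf_neq0.
  by move=> i j /negPf nij; rewrite mxE nij.
exists (\row_i g i i); last exact: diag_mx_intro.
move: Ug; rewrite (diag_mx_intro g0) unitmxE det_diag unitfE => /prodf_neq0 nz i.
by rewrite -(diag_mx_intro g0); have := nz i isT; rewrite mxE.
Qed.

Lemma polyfun_meval (p : {mpoly K[n * n]}) :
  polyfun (fun g : 'M[K]_n => p.@[mxvec g 0]).
Proof.
have -> : (fun g : 'M[K]_n => p.@[mxvec g 0]) = fun g =>
    \sum_(m <- msupp p) p@_m * \prod_i (mxvec g 0 i) ^+ m i.
  by apply/funext=> g; rewrite mevalE.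
apply: polyfun_sum => m; apply: polyfun_mul; first exact: polyfun_cst.
apply: polyfun_prod => i; apply: polyfun_exp; apply: polyfun_lin => c g h.
by rewrite linearP !mxE.
Qed.

Lemma zariski_closed_diag :
  zariski_closed [set g : 'M[K]_n | forall i j, i != j -> g i j = 0].
Proof.
exists [set p | exists i j, i != j /\ p = 'X_(mxvec_index i j)].
apply/funext=> g; apply/propext; split=> [g0 p [i [j [nij ->]]]|g0 i j nij].
  by rewrite mevalXU mxvecE g0.
by rewrite -mxvecE -mevalXU; apply: g0; exists i, j.
Qed.

Lemma zariski_closed_diag0 :
  zariski_closed [set g : 'M[K]_n | \prod_i g i i = 0].
Proof.
exists [set \prod_i 'X_(mxvec_index i i)]; apply/funext=> g; apply/propext.
have E : (\prod_i 'X_(mxvec_index i i) : {mpoly K[n * n]}).@[mxvec g 0] =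
    \prod_i g i i.
  by rewrite rmorph_prod; apply: eq_bigr => i _ /=; rewrite mevalXU mxvecE.
split=> [g0 p -> /=|/(_ _ erefl)]; by rewrite E.
Qed.

(** Diagonal matrices and matrices with a zero on the diagonal are closed, cover [G] and are
    disjoint on it, so a connected set through 1 is diagonal. Conversely, the line from 1 to a
    diagonal unit, minus its singular points, is connected. *)
Lemma id_component_diag (G : set 'M[K]_n) : diag_units `<=` G ->
  (forall g, G g -> g \in unitmx /\
     ((forall i, g i i != 0) -> forall i j, i != j -> g i j = 0)) ->
  id_component G = diag_units.
Proof.
move=> subG GP; apply/funext=> g; apply/propext; split=> [[C [CG Cc C1 Cg]]|].
  have [Ug gP] := GP g (CG g Cg).
  suff CD : C `<=` [set g | forall i j, i != j -> g i j = 0].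
    by apply/diag_unitsP; split=> //; apply: CD.
  have [|||CZ] // := Cc _ _ zariski_closed_diag zariski_closed_diag0.
  - move=> h /CG/GP[Uh hP]; have [h0|] := pselect (forall i, h i i != 0).
      by left; apply: hP.
    move=> /existsNP[i /negP/negPn/eqP hii]; right => /=.
    by rewrite (bigD1 i) //= hii mul0r.
  - apply/funext=> h; apply/propext; split=> // -[/CG/GP[Uh _] [h0]] /= dh0.
    move: Uh; rewrite (diag_mx_intro h0) unitmxE det_diag unitfE.
    by under eq_bigr do rewrite mxE; rewrite dh0 eqxx.
  have /eqP := CZ _ C1; rewrite /= big1 ?oner_eq0 // => i _.
  by rewrite mxE eqxx.
move=> [d d0 ->]; pose D : 'M[K]_n := diag_mx d.
pose L c : 'M[K]_n := 1%:M + c *: (D - 1%:M).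
pose C := [set h | exists2 c, h = L c & forall i, L c i i != 0].
have L_diag c i j : i != j -> L c i j = 0.
  by move=> /negPf nij; rewrite !mxE nij subrr mulr0 addr0.
have L0 : L 0 = 1%:M by rewrite /L scale0r addr0.
have L1 : L 1 = D by rewrite /L scale1r addrC subrK.
exists C; split.
- move=> _ [c -> Lc]; apply: subG; exists (\row_i L c i i).
    by move=> i; rewrite mxE.
  by apply: diag_mx_intro; apply: L_diag.
- move=> Z1 Z2 [I1 ->] [I2 ->] CZ _; apply: contrapT => /not_orP[].
  move=> /existsNP[_ /not_implyP[[c1 -> _]]] /existsNP[p1 /not_implyP[Ip1 /eqP np1]].
  move=> /existsNP[_ /not_implyP[[c2 -> _]]] /existsNP[p2 /not_implyP[Ip2 /eqP np2]].
  have Pdiag : polyfun (fun g : 'M[K]_n => \prod_i g i i).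
    apply: polyfun_prod => i; apply: polyfun_lin => c h k.
    by rewrite !mxE.
  have [||c12 [nz1 nz2]] := polyfun_line_neq0 charK0 (x := 1%:M) (v := D - 1%:M)
    (polyfun_meval p1) (polyfun_meval p2).
  + by exists c1.
  + by exists c2.
  (* The extra factor [Pdiag] keeps the common nonzero on the invertible part of the line. *)
  have [||c [nz12 nzd]] := polyfun_line_neq0 charK0 (x := 1%:M) (v := D - 1%:M)
    (polyfun_mul (polyfun_meval p1) (polyfun_meval p2)) Pdiag.
  + by exists c12; rewrite mulf_neq0.
  + exists 0; rewrite scale0r addr0; apply/prodf_neq0 => i _.
    by rewrite mxE eqxx oner_eq0.
  move: nz12; rewrite mulf_eq0 negb_or => /andP[n1 n2].
  have [] : ([set g | forall p, I1 p -> p.@[mxvec g 0] = 0] `|`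
             [set g | forall p, I2 p -> p.@[mxvec g 0] = 0]) (L c).
  + apply: CZ; exists c => // i.
    by move/prodf_neq0: nzd; apply.
  + by move/(_ _ Ip1)/eqP; rewrite (negPf n1).
  + by move/(_ _ Ip2)/eqP; rewrite (negPf n2).
- by exists 0; rewrite ?L0 // => i; rewrite mxE eqxx oner_eq0.
by exists 1; rewrite ?L1 // => i; rewrite mxE eqxx mulr1n.
Qed.

End IdentityComponent.

(** * The normalizer of the torus, its action on orbits, and isomorphisms *)

Section Normalizer.
Variables (K : closedFieldType) (T : vectType K) (alpha : nat -> 'Hom(T, K^o)).
Variable n : nat.
Hypothesis charK0 : [pchar K] =i pred0.
Hypothesis alpha_inj : injective alpha.
Implicit Types (phi psi chi : bilin K n) (g h : 'M[K]_n) (d l : 'rV[K]_n).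

Local Notation W := (weight_mx alpha n).
Local Notation normT := (normalizerT alpha (n := n)).

Lemma comm_diag_mx h d : injective (d 0) ->
  h *m diag_mx d = diag_mx d *m h -> forall i j, i != j -> h i j = 0.
Proof.
move=> inj_d; rewrite mul_diag_mx mul_mx_diag => /matrixP E i j nij.
have /eqP := E i j; rewrite !mxE mulrC -subr_eq0 -mulrBl mulf_eq0 subr_eq0.
by case/orP=> /eqP // /inj_d /esym/eqP; rewrite (negPf nij).
Qed.

Lemma mem_torus (D : 'M[K]_n) : reflect (exists t, D = W t) (D \in torus alpha n).
Proof.
apply: (iffP memv_imgP) => [[t _ ->]|[t ->]]; exists t; rewrite ?lfunE //.
exact: memvf.
Qed.

Lemma Gn_diag : Gn alpha n = @diag_units K n.
Proof.
have [t inj_t] := separating_vector n charK0 alpha_inj.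
apply: id_component_diag => // [g|g [Ug cg]].
  move=> [d d0 ->]; split; last first.
    move=> u; rewrite /weight_mx !mul_diag_mx; apply/matrixP=> i j; rewrite !mxE.
    by case: eqVneq => [->|_]; rewrite ?mulr0n ?mulr0 // mulrC.
  by rewrite unitmxE det_diag unitfE; apply/prodf_neq0.
by split=> // _; apply: comm_diag_mx inj_t (cg t).
Qed.

Lemma normalizerP h : normT h <-> [/\ h \in unitmx,
  forall t, exists t', h *m W t = W t' *m h
  & forall t, exists t', h *m W t' = W t *m h].
Proof.
split=> [[Uh Eh]|[Uh h1 h2]]; split=> //.
- move=> t; have : [set` torus alpha n] (h *m W t *m invmx h).
    by rewrite -Eh; exists (W t) => //; apply/mem_torus; exists t.
  by case/mem_torus=> t' E; exists t'; rewrite -E mulmxKV.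
- move=> t; have : [set` torus alpha n] (W t) by apply/mem_torus; exists t.
  rewrite -Eh => -[D /mem_torus[t' ->] <-]; exists t'.
  by rewrite mulmxKV.
apply/funext=> D; apply/propext; split=> [[E /mem_torus[t ->] <-]|/mem_torus[t ->]].
  by have [t' ->] := h1 t; rewrite mulmxK //; apply/mem_torus; exists t'.
have [t' E] := h2 t; exists (W t'); first by apply/mem_torus; exists t'.
by rewrite E mulmxK.
Qed.

Lemma normalizerM g h : normT g -> normT h -> normT (g *m h).
Proof.
move=> /normalizerP[Ug g1 g2] /normalizerP[Uh h1 h2]; apply/normalizerP; split.
- by rewrite unitmx_mul Ug.
- move=> t; have [u Eu] := h1 t; have [v Ev] := g1 u; exists v.
  by rewrite -mulmxA Eu !mulmxA Ev.
move=> t; have [u Eu] := g2 t; have [v Ev] := h2 u; exists v.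
by rewrite -mulmxA Ev !mulmxA Eu.
Qed.

Lemma normalizerV h : normT h -> normT (invmx h).
Proof.
move=> /normalizerP[Uh h1 h2]; apply/normalizerP; split.
- by rewrite unitmx_inv.
- move=> t; have [u Eu] := h2 t; exists u.
  by apply: (can_inj (mulKmx Uh)); rewrite !mulmxA Eu mulmxV // mul1mx mulmxK.
move=> t; have [u Eu] := h1 t; exists u.
by apply: (can_inj (mulKmx Uh)); rewrite !mulmxA Eu mulmxV // mul1mx mulmxK.
Qed.

Lemma normalizer_diag g : diag_units g -> normT g.
Proof.
move=> Dg; have /diag_unitsP[Ug g0] := Dg; apply/normalizerP.
have cg t : g *m W t = W t *m g.
  rewrite /weight_mx mul_mx_diag mul_diag_mx; apply/matrixP=> i j; rewrite !mxE.
  by have [->|/g0->] := eqVneq i j; rewrite ?mulr0 ?mul0r // mulrC.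
by split=> // t; exists t.
Qed.

(** [h] carries some [W u] to a separating [W t]; as [g] commutes with [W u], its conjugate commutes
    with [W t]. *)
Lemma normalizer_diag_conj g h : normT h -> diag_units g ->
  diag_units (h *m g *m invmx h).
Proof.
move=> /normalizerP[Uh h1 h2] /diag_unitsP[Ug g0]; apply/diag_unitsP.
split; first by rewrite !unitmx_mul Uh Ug unitmx_inv.
have [t inj_t] := separating_vector n charK0 alpha_inj.
apply: (comm_diag_mx inj_t); have [u Eu] := h2 t.
have cg : g *m W u = W u *m g.
  rewrite /weight_mx mul_mx_diag mul_diag_mx; apply/matrixP=> i j; rewrite !mxE.
  by have [->|/g0->] := eqVneq i j; rewrite ?mulr0 ?mul0r // mulrC.
have EV : invmx h *m W t = W u *m invmx h.
  by apply: (can_inj (mulKmx Uh)); rewrite !mulmxA Eu mulmxV // mul1mx mulmxK.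
rewrite -[diag_mx _]/(W t) -mulmxA EV !mulmxA -Eu -!mulmxA; congr (_ *m _).
by rewrite !mulmxA cg.
Qed.

(** For [g] with nonzero diagonal, the diagonal entries of [g *m W t = W u *m g] give [W u = W t],
    so [g] commutes with a separating element. *)
Lemma id_component_normalizer : id_component normT = @diag_units K n.
Proof.
have [t inj_t] := separating_vector n charK0 alpha_inj.
apply: id_component_diag => // [g|g /normalizerP[Ug g1 _]].
  exact: normalizer_diag.
split=> // nz_g; have [u Eu] := g1 t; apply: (comm_diag_mx inj_t).
rewrite -[diag_mx _]/(W t) Eu; congr (diag_mx _ *m _).
apply/matrixP=> i j; rewrite ord1 !mxE; apply: (mulIf (nz_g j)).
have /matrixP/(_ j j) := Eu.
by rewrite /weight_mx mul_mx_diag mul_diag_mx !mxE mulrC.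
Qed.

(** Diagonal factors move across [h] by normality, so a coset acts on orbits through any
    representative. *)
Lemma Gamma_act_orbit h phi : normT h ->
  Gamma_act [set h *m g | g in id_component normT] (Gn_orbit alpha phi) =
  Gn_orbit alpha (gact h phi).
Proof.
move=> Nh; have [Uh _ _] := (normalizerP h).1 Nh.
rewrite /Gn_orbit Gn_diag id_component_normalizer.
apply/funext=> psi; apply/propext; split.
  move=> [_ [g Dg <-] [_ [s Ds <-] <-]].
  have [[Ug _] [Us _]] := ((diag_unitsP g).1 Dg, (diag_unitsP s).1 Ds).
  exists (h *m (g *m s) *m invmx h).
    apply: normalizer_diag_conj => //; apply/diag_unitsP.
    split; first by rewrite unitmx_mul Ug.
    move=> i j nij; rewrite mxE big1 // => k _.
    have [Ek|nk] := eqVneq i k; last by rewrite ((diag_unitsP g).1 Dg).2 ?mul0r.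
    by rewrite ((diag_unitsP s).1 Ds).2 ?mulr0 // -Ek.
  rewrite !gactM ?unitmx_mul ?Uh ?Ug ?Us ?unitmx_inv //.
  by rewrite mulmxKV // mulmxA.
move=> [u Du <-]; have [Uu _] := (diag_unitsP u).1 Du.
exists (h *m (invmx h *m u *m h)).
  exists (invmx h *m u *m h) => //.
  have := normalizer_diag_conj (normalizerV Nh) Du.
  by rewrite invmxK.
exists phi; last by rewrite gactM // !mulmxA mulmxV // mul1mx.
exists 1%:M; last exact: gact1.
by exists (const_mx 1) => [i|]; rewrite ?mxE ?oner_eq0 // diag_const_mx.
Qed.

Lemma Gamma_orbitP psi chi :
  [set Gamma_act c (Gn_orbit alpha psi) | c in Gamma alpha n] (Gn_orbit alpha chi)
  <-> exists2 h, normT h & chi = gact h psi.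
Proof.
have chi_in : Gn_orbit alpha chi chi.
  exists 1%:M; last exact: gact1.
  rewrite Gn_diag; exists (const_mx 1) => [i|]; rewrite ?mxE ?oner_eq0 //.
  by rewrite diag_const_mx.
split=> [[_ [h Nh <-]]|[h Nh Echi]].
  have [Uh _ _] := (normalizerP h).1 Nh.
  rewrite Gamma_act_orbit // => E; move: chi_in; rewrite -E /Gn_orbit Gn_diag.
  move=> [u Du <-]; have [Uu _] := (diag_unitsP u).1 Du.
  exists (u *m h); last by rewrite gactM.
  by apply: normalizerM => //; apply: normalizer_diag.
exists [set h *m g | g in id_component normT]; first by exists h.
by rewrite Gamma_act_orbit // -Echi.
Qed.

(** Maximality of [T] among diagonal derivations, the form in which [killed_torus] delivers it. *)
Definition torus_full phi :=
  forall l, derivation phi (diag_mx l) -> exists t, l = wrow alpha n t.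

(** The conjugate of [W t] commutes with a diagonal matrix with distinct entries, hence is a
    diagonal derivation of [psi] and comes from [T]. *)
Lemma isom_torus phi psi h (e e' : 'rV[K]_n) : isom phi psi h -> injective (e' 0) ->
  h *m diag_mx e = diag_mx e' *m h -> lawsT alpha phi -> torus_full psi ->
  forall t, exists t', h *m W t = W t' *m h.
Proof.
move=> hP inj_e' E [_ dphi] fpsi t; have [Uh _] := hP.
pose X := h *m W t *m invmx h.
have X0 : forall i j, i != j -> X i j = 0.
  apply: (comm_diag_mx inj_e').
  have EV : invmx h *m diag_mx e' = diag_mx e *m invmx h.
    by apply: (can_inj (mulKmx Uh)); rewrite !mulmxA E mulmxV // mul1mx mulmxK.
  rewrite /X -!mulmxA EV [RHS]mulmxA -E -!mulmxA; congr (_ *m _).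
  by rewrite !mulmxA /weight_mx diag_mxC.
have dX : derivation psi X by apply: derivation_conj hP (dphi t).
have [v Ev] : exists v, \row_i X i i = wrow alpha n v.
  by apply: fpsi; rewrite -(diag_mx_intro X0).
exists v; rewrite -[W v]/(diag_mx (wrow alpha n v)) -Ev -(diag_mx_intro X0).
by rewrite /X mulmxKV.
Qed.

Lemma isomorphic_normalizer phi psi :
  lawsT alpha phi -> lawsT alpha psi -> torus_full phi -> torus_full psi ->
  isomorphic phi psi -> exists2 h, normT h & psi = gact h phi.
Proof.
move=> Lphi Lpsi fphi fpsi isoP.
have [t inj_t] := separating_vector n charK0 alpha_inj.
have [h [e [e' [hP inj_e inj_e' E]]]] :=
  isom_monomial charK0 isoP inj_t (Lphi.2 t) inj_t (Lpsi.2 t).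
exists h; last exact: isom_gactE.
have [Uh _] := hP; apply/normalizerP; split=> // u.
  exact: isom_torus hP inj_e' E Lphi fpsi u.
have EV : invmx h *m diag_mx e' = diag_mx e *m invmx h.
  by apply: (can_inj (mulKmx Uh)); rewrite !mulmxA E mulmxV // mul1mx mulmxK.
have [v Ev] := isom_torus (isomV hP) inj_e EV Lpsi fphi u.
exists v; apply: (can_inj (mulKmx (_ : invmx h \in unitmx))).
  by rewrite unitmx_inv.
by rewrite mulKmx // mulmxA Ev -mulmxA mulVmx // mulmx1.
Qed.

(** A larger torus commutes with a separating element of [T], so it consists of diagonal
    derivations. *)
Lemma Sigma_torus_full phi : lawsT alpha phi -> torus_full phi -> Sigma alpha n phi.
Proof.
move=> Lphi fphi; have [t inj_t] := separating_vector n charK0 alpha_inj.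
split=> //; split.
  split=> [D /mem_torus[u ->]|D /mem_torus[u ->]|D E /mem_torus[u ->] /mem_torus[v ->]].
  - exact: Lphi.2.
  - exists 1%:M; first exact: unitmx1.
    apply/diagonalizable_forP; first exact: unitmx1.
    move=> i j nij; rewrite mul1mx invmx1 mulmx1 mxE (_ : (i == j) = false) //.
    exact/negbTE.
  by rewrite /weight_mx diag_mxC.
move=> V [dV _ cV] sTV; apply/eqP; rewrite eqEsubv sTV andbT; apply/subvP=> D VD.
have D0 : forall i j, i != j -> D i j = 0.
  apply: (comm_diag_mx inj_t); apply: (cV _ _ VD).
  by apply: (subvP sTV); apply/mem_torus; exists t.
have [v Ev] : exists v, \row_i D i i = wrow alpha n v.
  by apply: fphi; rewrite -(diag_mx_intro D0); apply: dV.
by apply/mem_torus; exists v; rewrite (diag_mx_intro D0) Ev.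
Qed.

Lemma isom_lie_law phi psi g : isom phi psi g -> lie_law phi -> lie_law psi.
Proof.
move=> gP [alt jac]; have [Ug' gV] := isomV gP.
split=> [x|x y z]; apply: (can_inj (mulKmx Ug')).
  by rewrite gV alt mulmx0.
by rewrite !mulmxDr !gV jac mulmx0.
Qed.

Lemma gact_diag (s : 'rV[K]_n) phi i j k : (forall i, s 0 i != 0) ->
  gact (diag_mx s) phi (i, j, k) = s 0 k / (s 0 i * s 0 j) * phi (i, j, k).
Proof.
move=> nz_s; have Us : diag_mx s \in unitmx.
  by rewrite unitmxE det_diag unitfE; apply/prodf_neq0.
have [_ /(_ i j k)] := (isomE _ _ _).1 (isom_gact phi Us).
rewrite sum_diag_mxr.
under eq_bigr do under eq_bigr do rewrite -mulrA.
under eq_bigr do rewrite -mulr_sumr sum_diag_mxl.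
rewrite sum_diag_mxl mulrA => E.
by rewrite mulrAC E [_ * _ * gact _ _ _]mulrC mulfK // mulf_neq0.
Qed.

Lemma lawsT_gact_diag (s : 'rV[K]_n) phi : (forall i, s 0 i != 0) ->
  lawsT alpha phi -> lawsT alpha (gact (diag_mx s) phi).
Proof.
move=> nz_s Lphi; split.
  apply: isom_lie_law (isom_gact phi _) Lphi.1.
  by rewrite unitmxE det_diag unitfE; apply/prodf_neq0.
apply: weight_derivation => i j k; rewrite gact_diag // mulf_eq0 negb_or.
by move=> /andP[_ /(lawsT_weight Lphi)].
Qed.

End Normalizer.

(** * Admissible sets along a slice, and its isomorphism classes *)

Theorem theorem5p1 (K : closedFieldType) (charK0 : [pchar K] =i pred0)
    (T : vectType K) (alpha : nat -> 'Hom(T, K^o)) (n0 : nat)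
    (Q : simple_weight_path alpha n0) (n : nat) (le_n0n : (n0 <= n)%N)
    (phi0 : bilin K n) (phi0L : lawsT alpha phi0)
    (A : {set midx n}) (admA : admissible alpha phi0 A) :
  (forall phi, slice alpha phi0 A phi ->
     exists2 B : {set midx n}, A \subset B & admissible alpha phi B) /\
  (#|A| = (n - \dim {:T})%N ->
   [/\ forall phi, lawsT alpha phi ->
         (admissible alpha phi A <->
          forall i j k, (i, j, k) \in A -> phi (i, j, k) != 0),
       forall phi, slice alpha phi0 A phi -> admissible alpha phi A,
       slice alpha phi0 A `<=` Sigma alpha n /\
       iso_classes (slice alpha phi0 A) =
         [set C | C !=set0 /\
            exists2 w, Gamma_orbits alpha n w
                     & C = trace alpha (slice alpha phi0 A) w]
     & forall phi, lawsT alpha phi ->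
         (admissible alpha phi A <->
          exists2 s, Gn alpha n s & slice alpha phi0 A (gact s phi))]).
Proof.
have [[alpha_span _ _ _] alpha_inj] := Q.
have [sAw nzA indA _] := (admissibleP alpha_inj A phi0L).1 admA.
have nzS phi : slice alpha phi0 A phi -> forall a, a \in A -> phi a != 0.
  by move=> [_ Ephi] a aA; rewrite Ephi // nzA.
split=> [phi Sphi|cardA].
  by have [Lphi _] := Sphi; apply: admissible_extend (nzS _ Sphi) _.
have kerA l : killed A l -> exists t, l = wrow alpha n t.
  by move=> lA; apply: (killed_torus le_n0n alpha_span indA sAw cardA lA).
(* Vectors killed by [A] come from [T], and every form on the support of a law of [lawsT] vanishes
   on [T]; so the spanning condition is automatic. *)
have crit phi : lawsT alpha phi ->
    admissible alpha phi A <-> forall a, a \in A -> phi a != 0.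
  move=> Lphi; split=> [/(admissibleP alpha_inj A Lphi)[]//|nzphi].
  apply/(admissibleP alpha_inj A Lphi); split=> // l /kerA[t ->] [[i j] k].
  by move/(lawsT_weight Lphi); rewrite /wform !mxE => <-; rewrite add_lfunE subrr.
have fullS phi : slice alpha phi0 A phi -> torus_full alpha phi.
  move=> Sphi l /derivation_diag dl; apply: kerA => -[[i j] k] /(nzS _ Sphi)/dl.
  by rewrite /wform /= => ->; rewrite subrr.
have isoS phi chi : slice alpha phi0 A phi -> slice alpha phi0 A chi ->
    isomorphic phi chi <-> exists2 h, normalizerT alpha h & chi = gact h phi.
  move=> Sphi Schi; split=> [|[h [Uh _] ->]]; last by exists h.
  by apply: isomorphic_normalizer => //;
    [exact: Sphi.1 | exact: Schi.1 | exact: fullS | exact: fullS].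
split.
- move=> phi Lphi; rewrite crit //; split=> [nz i j k|nz [[i j] k]]; exact: nz.
- by move=> phi Sphi; apply/crit; [case: Sphi | exact: nzS].
- have SigS phi : slice alpha phi0 A phi -> Sigma alpha n phi.
    by move=> Sphi; apply: Sigma_torus_full; [| |case: Sphi|exact: fullS].
  split=> //.
  apply/funext=> C; apply/propext; split.
    move=> [phi Sphi <-]; split.
      exists phi; split=> //; apply/isomorphicP; exists 1%:M; exact: isom1.
    exists [set Gamma_act c (Gn_orbit alpha phi) | c in Gamma alpha n].
      by exists phi => //; apply: SigS.
    apply/funext=> chi; apply/propext; split=> -[Schi] chiP; split=> //.
      by apply/(Gamma_orbitP charK0 alpha_inj)/isoS.
    by apply/isoS => //; apply/(Gamma_orbitP charK0 alpha_inj).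
  (* The representative [psi] lies in [Sigma] but perhaps not in the slice; the law [phi] of the
     nonempty trace replaces it. *)
  move=> [[phi Cphi] [_ [psi _ <-] EC]].
  move: Cphi; rewrite EC => -[Sphi /(Gamma_orbitP charK0 alpha_inj)[h Nh Ephi]].
  have [Uh _] := Nh.
  exists phi => //; apply/funext=> chi; apply/propext; split=> -[Schi] chiP; split=> //.
    have /(isoS _ _ Sphi Schi)[k Nk ->] := chiP; have [Uk _] := Nk.
    apply/(Gamma_orbitP charK0 alpha_inj); exists (k *m h).
      exact: normalizerM.
    by rewrite Ephi gactM.
  have /(Gamma_orbitP charK0 alpha_inj)[k Nk Echi] := chiP; have [Uk _] := Nk.
  apply/isomorphicP; exists (k *m invmx h).
  apply: (isomM (psi := psi)); last by rewrite Echi; apply: isom_gact.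
  by apply: isomV; rewrite Ephi; apply: isom_gact.
move=> phi Lphi; rewrite crit // Gn_diag //; split=> [nz|[_ [s nz_s ->] [_ Es]] a aA].
  (* The ratios by which the diagonal action must rescale the coefficients at [A]. *)
  have [|s [nz_s Es]] := solve_weights indA (c := fun a => phi0 a / phi a).
    by move=> a aA; rewrite mulf_neq0 ?invr_eq0 ?nz ?nzA.
  exists (diag_mx (\row_i s i)).
    by exists (\row_i s i) => // i; rewrite mxE.
  have nz_row i : (\row_i s i) 0 i != 0 by rewrite mxE.
  split; first exact: lawsT_gact_diag.
  move=> [[i j] k] aA; rewrite gact_diag // !mxE.
  by have /= -> := Es _ aA; rewrite divfK // nz.
have := nzA _ aA; rewrite -Es //; apply: contraNneq => phi_a0.
by case: a aA phi_a0 => [[i j] k] _ E; rewrite gact_diag // E mulr0.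
Qed.
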